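(* Let $f\in S=\mathbb{C}[x_0,\dots,x_n]$ be a homogeneous polynomial of degree $d$ such that the projective hypersurface $V(f):f=0$ in $\mathbb{P}^n$ is reduced and has (at most) isolated singularities, located at the points $a_1,\dots,a_p$. Then for every $k=1,2,\dots,n+1$ and every sufficiently large integer $m$ one has $$\dim_{\mathbb{C}} H_k(f)_m=\sum_{i=1}^{p}\chi_k(V(f),a_i).$$
   Context: $S=\bigoplus_k S_k=\mathbb{C}[x_0,\dots,x_n]$ with the standard grading. For $f\in S_d$, $J_f$ is the ideal of $S$ generated by the partial derivatives $f_j=\partial f/\partial x_j$, $j=0,\dots,n$; $Hess(f)=(f_{ij})_{0\le i,j\le n}$ is the $(n+1)\times(n+1)$ matrix of second order partial derivatives; for $1\le k\le n+1$, $h_k(f)\subset S$ is the ideal generated by all $k\times k$ minors of $Hess(f)$. The graded $k$-th Hessian algebra of $f$ is $H_k(f)=S/(J_f+h_k(f))$, and $H_k(f)_m$ is its degree $m$ homogeneous component. Local version: let $\mathcal{O}_n=\mathbb{C}\{y_1,\dots,y_n\}$ be the ring of germs of analytic functions at $0\in\mathbb{C}^n$. For an isolated hypersurface singularity $(V,0)$ in $\mathbb{C}^n$ with (reduced) equation $g=0$, $g\in\mathcal{O}_n$, let $J_g$ be the ideal generated by the partial derivatives $g_1,\dots,g_n$; for $1\le k\le n$ let $h_k(g)$ be the ideal generated by all $k\times k$ minors of the $n\times n$ Hessian matrix $(g_{ij})$, and by convention $h_{n+1}(g)=0$. Put $H_k(g)=\mathcal{O}_n/((g)+J_g+h_k(g))$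 and $\chi_k(V,0)=\chi_k(g)=\dim_{\mathbb{C}}H_k(g)$ for $1\le k\le n+1$; this depends only on the isomorphism class of the germ $(V,0)$, so $\chi_k(V(f),a_i)$ is computed using any local equation of $V(f)$ at $a_i$ in local analytic coordinates of $\mathbb{P}^n$ centred at $a_i$. In particular $\chi_{n+1}$ is the Tjurina number $\tau$. *)

(* Defs.v *)
From HB Require Import structures.
From mathcomp Require Import all_boot all_order all_algebra.
From mathcomp Require Import boolp classical_sets reals.
From mathcomp Require Import complex.
From mathcomp Require Import mpoly.

Set Implicit Arguments.
Unset Strict Implicit.
Unset Printing Implicit Defensive.

Import Order.TTheory GRing.Theory Num.Theory.
Local Open Scope ring_scope.

Definition mseries (n : nat) (K : Type) := 'X_{1..n} -> K.

HB.instance Definition _ n K := gen_eqMixin (mseries n K).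
HB.instance Definition _ n K := gen_choiceMixin (mseries n K).

Section FormalSeries.
Variables (n : nat) (K : comNzRingType).
Implicit Types (a b c : mseries n K) (p q : {mpoly K[n]}) (m : 'X_{1..n}).

Definition mseries_zero : mseries n K := fun=> 0.
Definition mseries_one : mseries n K := fun m => (m == 0%MM)%:R.
Definition mseries_opp a : mseries n K := fun m => - a m.
Definition mseries_add a b : mseries n K := fun m => a m + b m.
Definition mseries_scale (x : K) a : mseries n K := fun m => x * a m.
Definition mseries_mul a b : mseries n K := fun m =>
  \sum_(k : 'X_{1..n < (mdeg m).+1, (mdeg m).+1} | m == (k.1 + k.2)%MM)
    a k.1 * b k.2.

Let trunc (d : nat) a : {mpoly K[n]} := \sum_(m : 'X_{1..n < d}) a m *: 'X_[m].

Let truncE d a m : (mdeg m < d)%N -> (trunc d a)@_m = a m.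
Proof. exact: mcoeff_mpoly. Qed.

Lemma mseries_mul_mcoeff p q a b m :
    (forall k, (mdeg k <= mdeg m)%N -> p@_k = a k) ->
    (forall k, (mdeg k <= mdeg m)%N -> q@_k = b k) ->
  mseries_mul a b m = (p * q)@_m.
Proof.
move=> pa qb; rewrite mcoeffM; apply: eq_bigr => k _.
by rewrite pa ?qb // -ltnS; apply: bmdeg.
Qed.

Lemma mseries_mulE d a b m : (mdeg m < d)%N ->
  mseries_mul a b m =
    \sum_(k : 'X_{1..n < d, d} | m == (k.1 + k.2)%MM) a k.1 * b k.2.
Proof.
move=> md; rewrite (@mseries_mul_mcoeff (trunc d a) (trunc d b)).
- rewrite (mcoeff_poly_mul _ _ md); apply: eq_bigr => k _.
  by rewrite !truncE //; apply: bmdeg.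
- by move=> k km; rewrite truncE // (leq_ltn_trans km).
- by move=> k km; rewrite truncE // (leq_ltn_trans km).
Qed.

Let mul_truncE d a b m : (mdeg m < d)%N ->
  mseries_mul a b m = (trunc d a * trunc d b)@_m.
Proof.
by move=> md; apply: mseries_mul_mcoeff => k km; rewrite truncE // (leq_ltn_trans km).
Qed.

Let addA : associative mseries_add.
Proof. by move=> a b c; apply/funext => m; apply: addrA. Qed.
Let addC : commutative mseries_add.
Proof. by move=> a b; apply/funext => m; apply: addrC. Qed.
Let add0 : left_id mseries_zero mseries_add.
Proof. by move=> a; apply/funext => m; apply: add0r. Qed.
Let addN : left_inverse mseries_zero mseries_opp mseries_add.
Proof. by move=> a; apply/funext => m; apply: addNr. Qed.

HB.instance Definition _ := GRing.isZmodule.Build (mseries n K) addA addC add0 addN.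

Let mulA : associative mseries_mul.
Proof.
move=> a b c; apply/funext => m; set d := (mdeg m).+1.
rewrite (@mseries_mul_mcoeff (trunc d a) (trunc d b * trunc d c)).
- rewrite mulrA (@mseries_mul_mcoeff (trunc d a * trunc d b) (trunc d c)) //.
  + by move=> k km; rewrite -mul_truncE.
  + by move=> k km; rewrite truncE.
- by move=> k km; rewrite truncE.
- by move=> k km; rewrite -mul_truncE.
Qed.
Let mulC : commutative mseries_mul.
Proof.
by move=> a b; apply/funext => m; rewrite !(@mul_truncE (mdeg m).+1) // mulrC.
Qed.
Let mul1 : left_id mseries_one mseries_mul.
Proof.
move=> a; apply/funext => m.
rewrite (@mseries_mul_mcoeff 1 (trunc (mdeg m).+1 a)) ?mul1r ?truncE //.
  by move=> k _; rewrite mcoeff1.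
by move=> k km; rewrite truncE.
Qed.
Let mulDl : left_distributive mseries_mul mseries_add.
Proof.
move=> a b c; apply/funext => m; set d := (mdeg m).+1.
rewrite (@mseries_mul_mcoeff (trunc d a + trunc d b) (trunc d c)).
- by rewrite mulrDl mcoeffD -!mul_truncE.
- by move=> k km; rewrite mcoeffD !truncE.
- by move=> k km; rewrite truncE.
Qed.
Let oner_neq0 : mseries_one != mseries_zero.
Proof.
apply/eqP => /(congr1 (fun f => f 0%MM)) /eqP.
by rewrite /mseries_one /mseries_zero eqxx oner_eq0.
Qed.

HB.instance Definition _ := GRing.Zmodule_isComNzRing.Build (mseries n K)
  mulA mulC mul1 mulDl oner_neq0.

Let scaleA x y a : mseries_scale x (mseries_scale y a) = mseries_scale (x * y) a.
Proof. by apply/funext => m; apply: mulrA. Qed.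
Let scale1 : left_id 1 mseries_scale.
Proof. by move=> a; apply/funext => m; apply: mul1r. Qed.
Let scaleDr : right_distributive mseries_scale +%R.
Proof. by move=> x a b; apply/funext => m; apply: mulrDr. Qed.
Let scaleDl a : {morph mseries_scale^~ a : x y / x + y}.
Proof. by move=> x y; apply/funext => m; apply: mulrDl. Qed.

HB.instance Definition _ := GRing.Zmodule_isLmodule.Build K (mseries n K)
  scaleA scale1 scaleDr scaleDl.

Let scaleAl (x : K) a b : x *: (a * b) = x *: a * b.
Proof.
apply/funext => m; rewrite /GRing.scale /= /mseries_scale mulr_sumr.
by apply: eq_bigr => k _; rewrite mulrA.
Qed.

HB.instance Definition _ := GRing.Lmodule_isLalgebra.Build K (mseries n K) scaleAl.
HB.instance Definition _ := GRing.Lalgebra_isComAlgebra.Build K (mseries n K).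

Definition mseries_deriv (i : 'I_n) a : mseries n K :=
  fun m => (m i).+1%:R * a (m + U_(i))%MM.

End FormalSeries.

Section ConvergentSeries.
Variables (n : nat) (K : numFieldType).
Implicit Types (a b : mseries n K) (r M : K).

Definition bounded_at r M a : Prop :=
  forall d, \sum_(m : 'X_{1..n < d}) `|a m| * r ^+ mdeg m <= M.

(* absolute convergence on a polydisc of positive radius; [r] and [M] are
   real because they are comparable to nonnegative numbers *)
Definition convergent a : Prop := exists r M, 0 < r /\ bounded_at r M a.

Definition convergent_pred : {pred mseries n K} := fun a => `[< convergent a >].

Let bounded_le r s M a : 0 < s -> s <= r -> bounded_at r M a -> bounded_at s M a.
Proof.
move=> s0 sr bM d; apply: le_trans (bM d); apply: ler_sum => m _.
by rewrite ler_wpM2l // lerXn2r // nnegrE ltW // (lt_le_trans s0).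
Qed.

Let common a b : convergent a -> convergent b ->
  exists r Ma Mb, [/\ 0 < r, bounded_at r Ma a & bounded_at r Mb b].
Proof.
move=> [r [Ma [r0 ba]]] [s [Mb [s0 bb]]].
have /orP[rs|sr] := real_leVge (gtr0_real r0) (gtr0_real s0).
  by exists r, Ma, Mb; split=> //; apply: bounded_le bb.
by exists s, Ma, Mb; split=> //; apply: bounded_le ba.
Qed.

Let card_bmnm d (x : 'X_{1..n}) :
  (#|[pred m : 'X_{1..n < d} | bmnm m == x]| <= 1)%N.
Proof.
apply/card_le1_eqP => m l; rewrite !inE => /eqP mx /eqP lx.
by apply: val_inj; rewrite /= mx lx.
Qed.

Lemma convergent1 : convergent (1 : mseries n K).
Proof.
exists 1, 1; split=> // d.
rewrite (eq_bigr (fun m : 'X_{1..n < d} => (bmnm m == 0%MM)%:R)); last first.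
  move=> m _; rewrite expr1n mulr1 /GRing.one /= /mseries_one.
  by rewrite normr_nat.
by rewrite -natr_sum lern1 -big_mkcond sum1_card card_bmnm.
Qed.

Lemma convergent_linear (x : K) a b :
  convergent a -> convergent b -> convergent (x *: a + b).
Proof.
move=> ca cb; have [r [Ma [Mb [r0 ba bb]]]] := common ca cb.
exists r, (`|x| * Ma + Mb); split=> // d.
apply: le_trans (lerD (ler_wpM2l (normr_ge0 x) (ba d)) (bb d)).
rewrite mulr_sumr -big_split /=; apply: ler_sum => m _.
rewrite mulrA -normrM -mulrDl; apply: ler_wpM2r.
  by rewrite exprn_ge0 ?ltW.
exact: (ler_normD (x * a m) (b m)).
Qed.

Lemma convergent_mul a b : convergent a -> convergent b -> convergent (a * b).
Proof.
move=> ca cb; have [r [Ma [Mb [r0 ba bb]]]] := common ca cb.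
have rX0 k : 0 <= r ^+ k by rewrite exprn_ge0 ?ltW.
exists r, (Ma * Mb); split=> // d.
pose F (m : 'X_{1..n}) : K := `|a m| * r ^+ mdeg m.
pose G (m : 'X_{1..n}) : K := `|b m| * r ^+ mdeg m.
have F0 m : 0 <= F m by rewrite mulr_ge0.
have G0 m : 0 <= G m by rewrite mulr_ge0.
apply: (@le_trans _ _ ((\sum_(m : 'X_{1..n < d}) F m) *
                       (\sum_(m : 'X_{1..n < d}) G m))); last first.
  by apply: ler_pM; rewrite ?sumr_ge0.
rewrite big_distrlr pair_bigA /=.
apply: (@le_trans _ _ (\sum_(m : 'X_{1..n < d})
    \sum_(k : 'X_{1..n < d, d} | bmnm m == (k.1 + k.2)%MM) F k.1 * G k.2)).
  apply: ler_sum => m _; rewrite [(a * b) m](mseries_mulE a b (bmdeg m)).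
  apply: le_trans (ler_wpM2r (rX0 _) (ler_norm_sum _ _ _)) _.
  rewrite mulr_suml; apply: ler_sum => k /eqP ->.
  by rewrite normrM mdegD exprD mulrACA.
rewrite (exchange_big_dep predT) //=; apply: ler_sum => k _.
by rewrite sumr_const -[leRHS]mulr1n ler_wpMn2l ?mulr_ge0 ?card_bmnm.
Qed.

Let ler_sum_inj (I J : finType) (h : I -> J) (F : J -> K) :
  injective h -> (forall j, 0 <= F j) -> \sum_i F (h i) <= \sum_j F j.
Proof.
move=> hI F0; rewrite -(big_imset _ (in2W hI)) [leRHS](bigID (mem (h @: I))%SET) /=.
by rewrite lerDl sumr_ge0.
Qed.

Let mnm_leq_mdeg (m : 'X_{1..n}) i : (m i <= mdeg m)%N.
Proof. by rewrite mdegE (bigD1 i) //= leq_addr. Qed.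

Let mdegDU (m : 'X_{1..n}) i : mdeg (m + U_(i))%MM = (mdeg m).+1.
Proof. by rewrite mdegD mdeg1 addn1. Qed.

Lemma convergent_deriv i a : convergent a -> convergent (mseries_deriv i a).
Proof.
move=> [r [M [r0 ba]]]; exists (r / 2), (r^-1 * M); split=> [|d].
  by rewrite divr_gt0.
have hP (m : 'X_{1..n < d}) : (mdeg (m + U_(i))%MM < d.+1)%N.
  by rewrite mdegDU ltnS bmdeg.
pose h (m : 'X_{1..n < d}) := BMultinom (hP m).
pose F (m : 'X_{1..n < d.+1}) : K := `|a m| * r ^+ mdeg m.
have hI : injective h.
  by move=> m k /(congr1 val) /= /addIm mk; apply: val_inj.
have rX0 k : 0 <= r ^+ k by rewrite exprn_ge0 ?ltW.
have F0 m : 0 <= F m by rewrite mulr_ge0.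
apply: (@le_trans _ _ (r^-1 * \sum_m F (h m))); last first.
  apply: ler_wpM2l; first by rewrite invr_ge0 ltW.
  exact: le_trans (ler_sum_inj hI F0) (ba d.+1).
rewrite mulr_sumr; apply: ler_sum => m _.
have -> : r^-1 * F (h m) = `|a (m + U_(i))%MM| * r ^+ mdeg m.
  by rewrite /F /= mdegDU exprS mulrCA mulKf ?gt_eqF.
rewrite normrM normr_nat expr_div_n [X in X * _]mulrC mulrACA.
apply: ler_piMr; first by rewrite mulr_ge0.
rewrite ler_pdivrMr ?exprn_gt0 // mul1r -natrX ler_nat.
exact: leq_ltn_trans (mnm_leq_mdeg m i) (ltn_expl _ _).
Qed.

Fact convergent_subalg : GRing.subalg_closed convergent_pred.
Proof.
split; first by apply/asboolP; apply: convergent1.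
  move=> x a b /asboolP ca /asboolP cb; apply/asboolP.
  exact: convergent_linear.
by move=> a b /asboolP ca /asboolP cb; apply/asboolP; apply: convergent_mul.
Qed.

HB.instance Definition _ :=
  GRing.isSubalgClosed.Build K (mseries n K) convergent_pred convergent_subalg.

(* C{y_1, ..., y_n}, when K is the field of complex numbers *)
Record germ := Germ { germ_coef :> mseries n K; _ : germ_coef \in convergent_pred }.

HB.instance Definition _ := [isSub for germ_coef].
HB.instance Definition _ := [Choice of germ by <:].
HB.instance Definition _ := [SubChoice_isSubLalgebra of germ by <:].
HB.instance Definition _ := [SubNzRing_isSubComNzRing of germ by <:].
HB.instance Definition _ := GRing.Lalgebra_isComAlgebra.Build K germ.

Lemma germ_convergent (g : germ) : convergent g.
Proof. by case: g => a /= /asboolP. Qed.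

Definition germ_of a (ca : convergent a) : germ := Germ (asboolT ca).

Definition germ_deriv (i : 'I_n) (g : germ) : germ :=
  germ_of (convergent_deriv i (germ_convergent g)).

Definition germ_at0 (g : germ) : K := germ_coef g 0%MM.

End ConvergentSeries.

Arguments germ n K : clear implicits.

Definition mpoly_germ (n N : nat) (K : numFieldType)
    (phi : 'I_N -> germ n K) (f : {mpoly K[N]}) : germ n K :=
  mmap (fun c : K => c%:A) phi f.

Local Open Scope classical_set_scope.

Definition ideal_gen (A : comNzRingType) (G : set A) : set A :=
  [set x | exists s : seq (A * A),
     (forall u, u \in s -> G u.2) /\ x = \sum_(u <- s) u.1 * u.2].

(* [quot_dim U W d] : the image of the subspace U in V / W, which is
   U / (U `&` W), has dimension d, i.e. admits a basis with d elements *)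
Definition quot_dim (K : fieldType) (V : lmodType K) (U W : set V) (d : nat) : Prop :=
  exists e : 'I_d -> V,
    [/\ forall i, U (e i),
        forall v, U v -> exists c : 'I_d -> K, W (v - \sum_i c i *: e i)
      & forall c : 'I_d -> K, W (\sum_i c i *: e i) -> forall i, c i = 0].

Section Hessian.
(* [D] is the family of partial derivatives, on polynomials or on germs *)
Variables (A : comNzRingType) (n : nat) (D : 'I_n -> A -> A).

Definition partials (f : A) : set A := [set x | exists i, x = D i f].

Definition hess (f : A) : 'M[A]_n := \matrix_(i, j) D i (D j f).

(* empty when k > n, so that the corresponding ideal is 0 *)
Definition minors (k : nat) (M : 'M[A]_n) : set A :=
  [set x | exists r c : 'I_k -> 'I_n,
     [/\ {homo r : i j / (i < j)%N}, {homo c : i j / (i < j)%N}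
       & x = \det (mxsub r c M)]].

End Hessian.

(* J_f + h_k(f) *)
Definition hess_ideal (K : fieldType) (N : nat) (f : {mpoly K[N]}) (k : nat)
    : set {mpoly K[N]} :=
  ideal_gen (partials (@mderiv N K) f `|` minors k (hess (@mderiv N K) f)).

Definition hess_algebra_dim (K : fieldType) (N : nat) (f : {mpoly K[N]})
    (k m d : nat) : Prop :=
  quot_dim [set q : {mpoly K[N]} | q \is m.-homog] (hess_ideal f k) d.

(* (g) + J_g + h_k(g) *)
Definition local_hess_ideal (n : nat) (K : numFieldType) (g : germ n K) (k : nat)
    : set (germ n K) :=
  ideal_gen ([set g] `|` partials (@germ_deriv n K) g
                     `|` minors k (hess (@germ_deriv n K) g)).

Definition local_hess_algebra_dim (n : nat) (K : numFieldType) (g : germ n K)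
    (k d : nat) : Prop :=
  quot_dim [set: germ n K] (local_hess_ideal g k) d.

Section Hypersurface.
Variables (n : nat) (K : numFieldType) (f : {mpoly K[n.+1]}).
Implicit Types x y a : 'I_n.+1 -> K.

(* points of P^n are given by homogeneous coordinates *)
Definition proj_point x : Prop := exists j, x j != 0.
Definition proj_eq x y : Prop := exists2 c, c != 0 & forall j, x j = c * y j.

(* reducedness of the hypersurface, as: S/(f) has no nonzero nilpotent element *)
Definition reduced_hypersurface : Prop :=
  forall (h q : {mpoly K[n.+1]}) (e : nat), h ^+ e = f * q ->
    exists q', h = f * q'.

Definition singular_point x : Prop :=
  [/\ proj_point x, f.@[x] = 0 & forall j, (f^`M(j)).@[x] = 0].

Definition singular_locus_is (p : nat) (a : 'I_p -> 'I_n.+1 -> K) : Prop :=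
  [/\ forall i, singular_point (a i),
      forall i j, proj_eq (a i) (a j) -> i = j
    & forall x, singular_point x -> exists i, proj_eq x (a i)].

(* The lift [phi] to K^(n+1) of an analytic map (K^n, 0) -> (P^n, a) is a
   system of local coordinates of P^n centred at a iff the differential of the
   map to P^n is invertible, i.e. iff phi(0) and the partial derivatives of phi
   at 0 form a basis of K^(n+1). *)
Definition local_coordinates a (phi : 'I_n.+1 -> germ n K) : Prop :=
  proj_eq (fun j => germ_at0 (phi j)) a /\
  row_mx (\col_j germ_at0 (phi j))
         (\matrix_(j, i) germ_at0 (germ_deriv i (phi j)))
    \in (unitmx : {pred 'M[K]_n.+1}).

Definition local_equation a (g : germ n K) : Prop :=
  exists phi u, [/\ local_coordinates a phi, germ_at0 u != 0
                  & g = u * mpoly_germ phi f].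

(* chi_k(V(f), a) = d; the first conjunct keeps the second from being vacuous *)
Definition chi_is (k : nat) a (d : nat) : Prop :=
  (exists g, local_equation a g) /\
  (forall g, local_equation a g -> local_hess_algebra_dim g k d).

End Hypersurface.

(* Main.v *)
From HB Require Import structures.
Require Import Defs.
From mathcomp Require Import all_boot all_order all_algebra.
From mathcomp Require Import boolp classical_sets reals.
From mathcomp Require Import complex.
From mathcomp Require Import fingroup perm mpoly ring.

(** Write S for the polynomial ring and I for the homogeneous ideal generated by
    the partial derivatives of f and the minors of its Hessian matrix.  By
    Euler's formula the zeros of I in projective space are among the singular
    points a_i.  The quotient S / I therefore defines a finite scheme, and in high
    degree (S / I)_m is its algebra of functions, the product of its local
    algebras; these are the local Hessian algebras of the singularities.

    The global half is [hilbert_function_local].  Choose a linear form l that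
    vanishes at no a_i.  By [projective_nullstellensatz], I and l together contain
    all forms of high degree, so multiplication by l from (S / I)_m to
    (S / I)_(m+1) is surjective for large m.  Since the dimensions are finite, it
    is eventually bijective, and (S / I)_m becomes the affine quotient by the
    ideal B generated by I and l - 1.  That quotient is finite dimensional with
    zeros among the points a_i / l(a_i), hence is the product of its
    localizations S / [local_ideal B a_i].  The finite dimension replaces
    Noetherian arguments everywhere: it makes each coordinate algebraic modulo B
    ([dehomog_algebraic]), and from there zeros are found by successive
    eigenvectors ([nullstellensatz_fin]).  The projective Nullstellensatz itself
    comes from the same dehomogenization, one coordinate at a time.

    The local half is [local_quot_dim_germ].  A system of local coordinates at a_i
    is rescaled to psi with l(psi) = 1, and q |-> q(psi) maps S to the germs.  It
    induces an isomorphism from S / [local_ideal B a_i] to the quotient of the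
    germs by the ideal generated by I.  Indeed, some power of the ideal of a_i
    lies in [local_ideal B a_i], modulo such a power every germ is a polynomial
    ([germ_jet]), and a form whose germ has high order has high order at the point
    ([mpoly_germ_vanish_homog]).

    It remains to compare the ideals ([hess_ideal_local]).  The matrix J with
    columns psi and its partial derivatives is invertible.  By the chain rule and
    Euler's formula, J^T Hess(f)(psi) J is, modulo the first partial derivatives,
    the Hessian matrix of f(psi) bordered by a zero row and a zero column, and
    invertible matrices do not change ideals of minors.  Multiplying f(psi) by a
    unit does not change its local ideal either ([local_hess_ideal_unit]). *)

Set Implicit Arguments.
Unset Strict Implicit.
Unset Printing Implicit Defensive.

Import Order.TTheory GRing.Theory Num.Theory.
Local Open Scope classical_set_scope.
Local Open Scope ring_scope.

(** * Ideals given by predicates *)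

Definition is_ideal (A : comNzRingType) (I : set A) : Prop :=
  [/\ I 0, forall x y, I x -> I y -> I (x + y) & forall a x, I x -> I (a * x)].

Section Ideals.
Variable A : comNzRingType.
Implicit Types (I G H : set A) (x y a h : A).

Lemma ideal_zero I (II : is_ideal I) : I 0. Proof. by case: II. Qed.

Lemma ideal_add I (II : is_ideal I) x y : I x -> I y -> I (x + y).
Proof. by case: II => _ + _; apply. Qed.

Lemma ideal_mull I (II : is_ideal I) a x : I x -> I (a * x).
Proof. by case: II => _ _; apply. Qed.

Lemma ideal_mulr I (II : is_ideal I) a x : I x -> I (x * a).
Proof. by rewrite mulrC; apply: (ideal_mull II). Qed.

Lemma ideal_opp I (II : is_ideal I) x : I x -> I (- x).
Proof. by rewrite -mulN1r; apply: (ideal_mull II). Qed.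

Lemma ideal_sub I (II : is_ideal I) x y : I x -> I y -> I (x - y).
Proof. by move=> Ix Iy; apply: (ideal_add II) => //; apply: (ideal_opp II). Qed.

Lemma ideal_subK I (II : is_ideal I) x y : I (x - y) -> I y -> I x.
Proof. by move=> Ixy Iy; rewrite -(subrK y x); apply: (ideal_add II). Qed.

Lemma ideal_sum I (II : is_ideal I) (T : Type) (r : seq T) (P : pred T) (F : T -> A) :
  (forall i, P i -> I (F i)) -> I (\sum_(i <- r | P i) F i).
Proof.
move=> IF; apply: big_ind => //; first exact: ideal_zero II.
by move=> x y; apply: (ideal_add II).
Qed.

Lemma ideal_genP G : is_ideal (ideal_gen G).
Proof.
split; first by exists [::]; rewrite big_nil; split.
  move=> _ _ [s [sG ->]] [t [tG ->]]; exists (s ++ t); split; last first.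
    by rewrite big_cat.
  by move=> u; rewrite mem_cat => /orP[/sG|/tG].
move=> a _ [s [sG ->]]; exists [seq (a * u.1, u.2) | u <- s]; split.
  by move=> _ /mapP[u /sG us ->].
by rewrite big_map mulr_sumr; apply: eq_bigr => u _; rewrite mulrA.
Qed.

Lemma ideal_gen_in G : G `<=` ideal_gen G.
Proof.
move=> x Gx; exists [:: (1, x)]; rewrite big_seq1 mul1r; split=> // u.
by rewrite inE => /eqP ->.
Qed.

Lemma ideal_gen_min G I : is_ideal I -> G `<=` I -> ideal_gen G `<=` I.
Proof.
move=> II GI _ [s [sG ->]]; rewrite big_seq_cond; apply: (ideal_sum II) => u.
by rewrite andbT => /sG /GI; apply: (ideal_mull II).
Qed.

Lemma ideal_gen_mono G H : G `<=` ideal_gen H -> ideal_gen G `<=` ideal_gen H.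
Proof. exact: ideal_gen_min (ideal_genP H). Qed.

Lemma ideal_genU1 G h x :
  ideal_gen (G `|` [set h]) x <-> exists y s, ideal_gen G y /\ x = y + s * h.
Proof.
split; last first.
  move=> [y [s [Gy ->]]]; apply: (ideal_add (ideal_genP _)).
    by apply: ideal_gen_mono Gy => z Gz; apply: ideal_gen_in; left.
  by apply: (ideal_mull (ideal_genP _)); apply: ideal_gen_in; right.
move: x; apply: ideal_gen_min.
  split.
  - by exists 0, 0; rewrite mul0r addr0; split=> //; apply: ideal_zero (ideal_genP _).
  - move=> _ _ [y [s [Gy ->]]] [z [t [Gz ->]]]; exists (y + z), (s + t); split.
      by apply: (ideal_add (ideal_genP _)).
    by rewrite mulrDl addrACA.
  - move=> a _ [y [s [Gy ->]]]; exists (a * y), (a * s); split.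
      by apply: (ideal_mull (ideal_genP _)).
    by rewrite mulrDr mulrA.
move=> x [Gx|->].
  by exists x, 0; rewrite mul0r addr0; split=> //; apply: ideal_gen_in.
by exists 0, 1; rewrite mul1r add0r; split=> //; apply: ideal_zero (ideal_genP _).
Qed.

End Ideals.

Lemma ideal_preim (A B : comNzRingType) (f : {rmorphism A -> B}) (I : set B) :
  is_ideal I -> is_ideal [set x | I (f x)].
Proof.
move=> II; split=> [|x y|a x] /=.
- by rewrite rmorph0; apply: ideal_zero II. 
- by rewrite rmorphD; exact: (ideal_add II).
- by rewrite rmorphM; exact: (ideal_mull II).
Qed.

Lemma ideal_gen_morph (A B : comNzRingType) (f : {rmorphism A -> B})
    (G : set A) (H : set B) :
  (forall y, G y -> ideal_gen H (f y)) ->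
  forall x, ideal_gen G x -> ideal_gen H (f x).
Proof.
move=> GH; apply: (@ideal_gen_min _ G [set x | ideal_gen H (f x)]) => //.
exact: ideal_preim (ideal_genP H).
Qed.

(** * Subspaces of finite codimension given by predicates *)

Definition is_subspace (K : fieldType) (V : lmodType K) (W : set V) : Prop :=
  W 0 /\ forall c x y, W x -> W y -> W (c *: x + y).

Section Subspaces.
Variables (K : fieldType) (V : lmodType K).
Implicit Types (U W : set V) (d m n : nat).

Lemma subspaceD W (SW : is_subspace W) x y : W x -> W y -> W (x + y).
Proof. by case: SW => [_ WL] Wx Wy; rewrite -(scale1r x); apply: WL. Qed.
Lemma subspaceZ W (SW : is_subspace W) c x : W x -> W (c *: x).
Proof. by case: SW => [W0 WL] Wx; rewrite -(addr0 (c *: x)); apply: WL. Qed.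
Lemma subspace_sum W (SW : is_subspace W)
    (T : Type) (r : seq T) (P : pred T) (F : T -> V) :
  (forall i, P i -> W (F i)) -> W (\sum_(i <- r | P i) F i).
Proof.
move=> WF; apply: big_ind => //; first by case: SW.
by move=> x y; apply: (subspaceD SW).
Qed.

Definition spans_mod (n : nat) (e : 'I_n -> V) U W : Prop :=
  forall v, U v -> exists c : 'I_n -> K, W (v - \sum_i c i *: e i).

Lemma spans_modS n (e : 'I_n -> V) U W W' :
  W `<=` W' -> spans_mod e U W -> spans_mod e U W'.
Proof. by move=> WW' span v /span[c Wc]; exists c; apply: WW'. Qed.

(** The coordinates with respect to the spanning family form a matrix with more
    rows than columns. *)
Lemma spans_mod_dep m n (e : 'I_n -> V) (v : 'I_m -> V) U W :
    is_subspace W -> spans_mod e U W -> (forall j, U (v j)) -> (n < m)%N ->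
  exists2 c : 'I_m -> K, (exists j, c j != 0) & W (\sum_j c j *: v j).
Proof.
move=> SW span Uv nm.
have /choice[C CP] j := span _ (Uv j).
pose M := \matrix_(j, i) C j i.
have : kermx M != 0.
  rewrite -mxrank_eq0 mxrank_ker subn_eq0 -ltnNge.
  exact: leq_ltn_trans (rank_leq_col M) nm.
case/rowV0Pn => x /sub_kermxP xM x0.
exists (fun j => x 0 j).
  by case/rV0Pn: x0 => j xj; exists j.
have -> : \sum_j x 0 j *: v j =
    \sum_j x 0 j *: (v j - \sum_i C j i *: e i).
  under [RHS]eq_bigr do rewrite scalerBr.
  rewrite sumrB [X in _ - X](_ : _ = 0) ?subr0 //.
  under eq_bigr do rewrite scaler_sumr.
  rewrite exchange_big big1 //= => i _.
  under eq_bigr do rewrite scalerA.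
  rewrite -scaler_suml [X in X *: _](_ : _ = (x *m M) 0 i).
    by rewrite xM mxE scale0r.
  by rewrite mxE; apply: eq_bigr => j _; rewrite mxE.
by apply: (subspace_sum SW) => // j _; apply: (subspaceZ SW).
Qed.

(** A spanning family of minimal size is independent modulo [W]. *)
Lemma quot_dim_exists n (e : 'I_n -> V) U W :
    is_subspace W -> (forall i, U (e i)) -> spans_mod e U W ->
  exists d, quot_dim U W d.
Proof.
move=> SW Ue span.
pose P d := `[< exists2 b : 'I_d -> V, forall i, U (b i) & spans_mod b U W >].
have exP : exists d, P d by exists n; apply/asboolP; exists e.
case: (ex_minnP exP) => d /asboolP[b Ub bspan] dmin; exists d, b; split=> //.
move=> c Wc i; apply: contrapT => /eqP ci.
case: d => [|d] in b Ub bspan dmin c Wc i ci *; first by case: i ci.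
suff /dmin : P d by rewrite ltnn.
apply/asboolP; exists (b \o lift i) => [j|v Uv]; first exact: Ub.
have [x Wx] := bspan v Uv.
(* the dependency expresses [b i] by the other vectors *)
exists (fun j => x (lift i j) - x i / c i * c (lift i j)).
have -> : v - \sum_j (x (lift i j) - x i / c i * c (lift i j)) *: (b \o lift i) j
    = (v - \sum_j x j *: b j) + (x i / c i) *: \sum_j c j *: b j.
  rewrite -addrA; congr (_ + _); rewrite scaler_sumr -[in RHS]sumrN -big_split /=.
  rewrite [RHS](bigD1_ord i) //= [X in _ = X + _](_ : _ = 0); last first.
    by rewrite scalerA divfK // addNr.
  rewrite add0r -sumrN; apply: eq_bigr => j _.
  by rewrite scalerA scalerBl opprB addrC.
by apply: (subspaceD SW) => //; apply: (subspaceZ SW).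
Qed.

Lemma quot_dim_fin (T : finType) (b : T -> V) U W :
    (forall t, U (b t)) ->
    (forall v, U v -> exists c : T -> K, W (v - \sum_t c t *: b t)) ->
    (forall c : T -> K, W (\sum_t c t *: b t) -> forall t, c t = 0) ->
  quot_dim U W #|T|.
Proof.
move=> Ub span indep; exists (b \o enum_val); split=> [i|v Uv|c Wc i].
- exact: Ub.
- have [c Wc] := span v Uv; exists (c \o enum_val).
  by rewrite (reindex _ (onW_bij _ (enum_val_bij T))) in Wc.
- rewrite -(enum_valK i); apply: (indep (c \o enum_rank)).
  rewrite (reindex _ (onW_bij _ (enum_val_bij T))) /=.
  by under eq_bigr do rewrite enum_valK.
Qed.

End Subspaces.

(** The rank of a matrix with rows in [U] is bounded; a matrix of maximal rank
    spans [U]. *)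
Lemma subspace_rowspace (K : fieldType) n (U : set 'rV[K]_n) :
  is_subspace U -> exists A : 'M[K]_n, forall v, U v <-> (v <= A)%MS.
Proof.
move=> SU.
pose P r := `[< exists2 A : 'M[K]_n, \rank A = r &
                  forall v : 'rV_n, (v <= A)%MS -> U v >].
have exP : exists r, P r.
  exists 0%N; apply/asboolP; exists 0; rewrite ?mxrank0 // => v.
  by rewrite submx0 => /eqP ->; case: SU.
have bound r : P r -> (r <= n)%N by move=> /asboolP[A <- _]; apply: rank_leq_row.
case: (ex_maxnP exP bound) => r /asboolP[A rA AU] rmax.
exists A => v; split; last exact: AU.
move=> Uv; apply: contrapT => /negP vA.
suff /rmax : P (\rank (A + v)%MS).
  rewrite leqNgt -rA => /negP; apply.
  rewrite ltn_neqAle mxrankS ?addsmxSl // andbT.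
  apply: contra vA => /eqP rAv.
  have /mxrank_leqif_sup/leqifP := addsmxSl A v.
  case: ifP => [/(submx_trans (addsmxSr A v)) //|_].
  by rewrite rAv ltnn.
apply/asboolP; exists (A + v)%MS => // w /sub_addsmxP[[x y] ->].
apply: (subspaceD SU) => //; first by apply/AU/submxMl.
by rewrite [y]mx11_scalar mul_scalar_mx; apply: (subspaceZ SU).
Qed.

Lemma subspace_acc (K : fieldType) n (U : nat -> set 'rV[K]_n) :
    (forall s, is_subspace (U s)) -> (forall s, U s `<=` U s.+1) ->
  exists s0, forall s, U s `<=` U s0.
Proof.
move=> SU Uinc.
have /choice[A AP] s := subspace_rowspace (SU s).
have mono s t : (s <= t)%N -> U s `<=` U t.
  elim: t => [|t IH]; first by rewrite leqn0 => /eqP ->.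
  rewrite leq_eqVlt => /orP[/eqP -> //|st] v /(IH st); exact: Uinc.
pose P r := `[< exists s, \rank (A s) = r >].
have exP : exists r, P r by exists (\rank (A 0%N)); apply/asboolP; exists 0%N.
have bound r : P r -> (r <= n)%N by move=> /asboolP[s <-]; apply: rank_leq_row.
case: (ex_maxnP exP bound) => r /asboolP[s0 rs0] rmax.
exists s0 => s; have [/mono //|/ltnW ss0] := leqP s s0.
have sA : (A s0 <= A s)%MS.
  by apply/rV_subP => v /AP /(mono _ _ ss0) /AP.
move=> v /AP vs; apply/AP; apply: submx_trans vs _.
have /mxrank_leqif_sup/leqifP := sA; case: ifP => // _.
by rewrite rs0 ltnNge rmax //; apply/asboolP; exists s.
Qed.

(** * Polynomials and homogeneous ideals *)

Lemma mpoly_ring_ind (R : comNzRingType) n (P : {mpoly R[n]} -> Prop) :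
    (forall c, P c%:MP) -> (forall i, P 'X_i) ->
    (forall p q, P p -> P q -> P (p + q)) ->
    (forall p q, P p -> P q -> P (p * q)) ->
  forall p, P p.
Proof.
move=> PC PX PD PM; apply: mpolyind => [|c m p _ _ Pp].
  by rewrite -mpolyC0; apply: PC.
apply: PD => //; rewrite -mul_mpolyC mpolyXE_id; apply: (PM) => //.
have P1 : P 1 by rewrite -mpolyC1; apply: PC.
apply: (big_ind P P1 PM) => i _; elim: (m i) => [|k IH]; first by rewrite expr0.
by rewrite exprS; apply: PM.
Qed.

Lemma mnm_neq0 n (m : 'X_{1..n}) : m != 0%MM -> exists i, m i != 0%N.
Proof.
move=> m0; apply: contrapT => nm; case/eqP: m0; apply/mnmP => i; rewrite mnm0E.
by apply: contrapT => /eqP mi; apply: nm; exists i.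
Qed.

Lemma mnm_subUK n (m : 'X_{1..n}) i : m i != 0%N -> (m - U_(i) + U_(i))%MM = m.
Proof. by move=> mi; rewrite submK // lep1mP. Qed.

Lemma mdeg_subU n (m : 'X_{1..n}) i : m i != 0%N -> mdeg m = (mdeg (m - U_(i))).+1.
Proof. by move=> /mnm_subUK{1}<-; rewrite mdegD mdeg1 addn1. Qed.

Lemma ideal_mpolyZ (R : comNzRingType) n (I : set {mpoly R[n]}) (II : is_ideal I) c q :
  I q -> I (c *: q).
Proof. by rewrite -mul_mpolyC; apply: (ideal_mull II). Qed.

Lemma ideal_subspace (K : fieldType) n (I : set {mpoly K[n]}) :
  is_ideal I -> is_subspace I.
Proof.
move=> II; split=> [|c x y Ix Iy]; first exact: ideal_zero II.
by apply: (ideal_add II) => //; apply: (ideal_mpolyZ II).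
Qed.

(** Over an algebraically closed field this is all that is used of the finite
    dimension of the quotient by [I]. *)
Definition coords_algebraic (K : fieldType) n (I : set {mpoly K[n]}) : Prop :=
  forall j, exists r : seq K, I (\prod_(z <- r) ('X_j - z%:MP)).

(** Nullstellensatz for ideals of finite codimension.  The coordinates act on
    the quotient as commuting operators with split annihilators; successive
    eigenvectors yield [w] outside [I] which is a common eigenvector, and the
    eigenvalues are then the coordinates of a zero of [I]. *)
Lemma nullstellensatz_fin (K : fieldType) n (I : set {mpoly K[n]}) :
    is_ideal I -> coords_algebraic I ->
    (forall x, ~ (forall q, I q -> q.@[x] = 0)) ->
  I 1.
Proof.
move=> II Ialg noz; apply: contrapT => I1.
have eigen j w : ~ I w -> exists z s, ~ I (s * w) /\ I (('X_j - z%:MP) * (s * w)).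
  move=> Iw; have [r] := Ialg j => /(ideal_mulr II w).
  elim: r => [|z r IH]; first by rewrite big_nil mul1r.
  rewrite big_cons -mulrA => Ir.
  have [/IH //|nIr] := pselect (I ((\prod_(z <- r) ('X_j - z%:MP)) * w)).
  by exists z, (\prod_(z <- r) ('X_j - z%:MP)).
have common (s : seq 'I_n) : exists x : 'I_n -> K, exists2 w, ~ I w &
    forall j, j \in s -> I (('X_j - (x j)%:MP) * w).
  elim: s => [|j s [x [w Iw Iws]]]; first by exists (fun=> 0), 1.
  have [z [u [Iuw Izuw]]] := eigen j w Iw.
  exists (fun i => if i == j then z else x i), (u * w) => // i.
  rewrite inE; have [-> _ //|_ /= /Iws] := eqVneq i j.
  by rewrite mulrCA; apply: (ideal_mull II).
have [x [w Iw Iwx]] := common (enum 'I_n).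
have Ix q : I ((q - q.@[x]%:MP) * w).
  elim/mpoly_ring_ind: q => [c|i|p q Ip Iq|p q Ip Iq].
  - by rewrite mevalC subrr mul0r; apply: ideal_zero II.
  - by rewrite mevalXU; apply: Iwx; rewrite mem_enum.
  - by rewrite mevalD mpolyCD opprD addrACA mulrDl; apply: (ideal_add II).
  - have -> : (p * q - (p * q).@[x]%:MP) * w =
        q * ((p - p.@[x]%:MP) * w) + p.@[x]%:MP * ((q - q.@[x]%:MP) * w).
      rewrite mevalM mpolyCM !mulrA -mulrDl; congr (_ * w).
      by rewrite mulrBr mulrBr [q * p]mulrC [q * _%:MP]mulrC addrA subrK.
    by apply: (ideal_add II); apply: (ideal_mull II).
apply: (noz x) => q Iq; apply: contrapT => /eqP qx.
apply: Iw; rewrite -(scale1r w) -(mulVf qx) -scalerA -(mul_mpolyC q.@[x]).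
apply: (ideal_mpolyZ II).
have -> : q.@[x]%:MP * w = q * w - (q - q.@[x]%:MP) * w.
  by rewrite mulrBl opprB addrC subrK.
by apply: (ideal_sub II) => //; apply: (ideal_mulr II).
Qed.

Section Homogeneous.
Variables (K : fieldType) (n : nat).
Implicit Types (G : set {mpoly K[n]}) (p q s : {mpoly K[n]}).

Local Notation pih := (pihomog mdeg).

Lemma meval_homog d q c (y : 'I_n -> K) : q \is d.-homog ->
  q.@[fun j => c * y j] = c ^+ d * q.@[y].
Proof.
move=> qd; rewrite [q]mpolyE !raddf_sum mulr_sumr /= !big_seq.
apply: eq_bigr => m /(dhomog_mf qd) <-.
rewrite !mevalZ !mevalX mulrCA; congr (_ * _).
under eq_bigr do rewrite exprMn.
by rewrite big_split /= prodrXr mdegE.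
Qed.

Definition homog_set G : Prop := forall g, G g -> exists t, g \is t.-homog.

Lemma pihomog_partition p k : (msize p <= k)%N -> p = \sum_(d < k) pih d p.
Proof. exact: pihomog_partitionE. Qed.

Lemma pihomogMr_sum s u t m : u \is t.-homog ->
  pih m (s * u) = \sum_(d < msize s | (d + t == m)%N) pih d s * u.
Proof.
move=> ut; rewrite {1}(pihomog_partition (leqnn (msize s))) mulr_suml raddf_sum /=.
rewrite [RHS]big_mkcond; apply: eq_bigr => d _.
have dt : pih d s * u \is (d + t).-homog by apply: dhomogM ut; apply: pihomogP.
case: eqP => [<-|/eqP ne]; first by rewrite pihomog_dE.
by rewrite (pihomog_ne0 ne dt).
Qed.

Lemma pihomogMr s u t m : u \is t.-homog -> pih (m + t) (s * u) = pih m s * u.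
Proof.
move=> ut; rewrite (pihomogMr_sum _ _ ut).
under eq_bigl do rewrite eqn_add2r.
have [mk|mk] := ltnP m (msize s).
  rewrite (eq_bigl (fun d : 'I__ => d == Ordinal mk)) ?big_pred1_eq //.
rewrite big_pred0 => [|d]; last first.
  by apply/negbTE; rewrite neq_ltn (leq_trans (ltn_ord d)).
rewrite pihomogE big_seq_cond big_pred0 ?mul0r // => x.
apply/negbTE/negP => /andP[xs /eqP xm]; move: mk.
by rewrite leqNgt -xm msize_mdeg_lt.
Qed.

Lemma ideal_gen_pihomog G q m :
  homog_set G -> ideal_gen G q -> ideal_gen G (pih m q).
Proof.
move=> Gh [s [sG ->]]; rewrite raddf_sum big_seq_cond.
apply: (ideal_sum (ideal_genP G)) => u /=; rewrite andbT => /sG Gu.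
have [t ut] := Gh _ Gu; rewrite (pihomogMr_sum _ _ ut).
apply: (ideal_sum (ideal_genP G)) => d _.
by apply: (ideal_mull (ideal_genP G)); apply: ideal_gen_in.
Qed.

(** Multiplying the homogeneous components by powers of the linear form [l]
    so that all get degree [k]; modulo [l - 1] this changes nothing. *)
Definition homogenize (l : {mpoly K[n]}) k q : {mpoly K[n]} :=
  \sum_(d < k.+1) l ^+ (k - d) * pih d q.

Section Homogenize.
Variable l : {mpoly K[n]}.
Hypothesis l1 : l \is 1.-homog.

Lemma dhomog_exp k : l ^+ k \is k.-homog.
Proof. by rewrite -{2}(mul1n k); apply: dhomogMn. Qed.

Lemma homogenize_is_linear k : linear (homogenize l k).
Proof.
move=> c p q; rewrite /homogenize scaler_sumr -big_split /=; apply: eq_bigr => d _.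
by rewrite linearP /= mulrDr scalerAr.
Qed.
HB.instance Definition _ k :=
  GRing.isLinear.Build K _ _ _ (homogenize l k) (homogenize_is_linear k).

Lemma homogenizeP k q : homogenize l k q \is k.-homog.
Proof.
apply: rpred_sum => d _.
have := dhomogM (dhomog_exp (k - d)) (pihomogP mdeg d q).
by rewrite subnK // -ltnS.
Qed.

Lemma homogenize_homog k m q :
  q \is m.-homog -> (m <= k)%N -> homogenize l k q = l ^+ (k - m) * q.
Proof.
rewrite -ltnS => qm mk; rewrite /homogenize (bigD1 (Ordinal mk)) //= pihomog_dE //.
rewrite big1 ?addr0 // => d; rewrite -val_eqE /= eq_sym => dm.
by rewrite (pihomog_ne0 dm qm) mulr0.
Qed.

Lemma homogenizeM k s : (msize s <= k)%N -> homogenize l k (s * (l - 1)) = 0.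
Proof.
move=> sk; rewrite {1}(pihomog_partition sk) mulr_suml raddf_sum big1 //= => d _.
have sd := pihomogP mdeg d s.
have sld : pih d s * l \is d.+1.-homog by rewrite -addn1; apply: dhomogM.
rewrite mulrBr mulr1 raddfB /= (homogenize_homog sld) // (homogenize_homog sd).
  by rewrite [_ * l]mulrC mulrA -exprSr -subSn // subSS subrr.
exact: ltnW.
Qed.

Lemma homogenize_ideal G k q :
  homog_set G -> ideal_gen G q -> ideal_gen G (homogenize l k q).
Proof.
move=> Gh Gq; apply: (ideal_sum (ideal_genP G)) => d _.
by apply: (ideal_mull (ideal_genP G)); apply: ideal_gen_pihomog.
Qed.

Lemma homogenize_mod (I : set {mpoly K[n]}) k q : is_ideal I -> I (l - 1) ->
  (msize q <= k.+1)%N -> I (homogenize l k q - q).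
Proof.
move=> II Il qk; rewrite {2}(pihomog_partition qk) -sumrB.
apply: (ideal_sum II) => d _; rewrite -{2}(mul1r (pih d q)) -mulrBl.
apply: (ideal_mulr II); rewrite subrX1; exact: (ideal_mulr II).
Qed.

End Homogenize.
End Homogeneous.

(** * Dehomogenization in high degree *)

Section Stable.
Variables (K : closedFieldType) (n : nat).
Variables (G : set {mpoly K[n]}) (l : {mpoly K[n]}) (M : nat).
Hypothesis Ghom : homog_set G.
Hypothesis l1 : l \is 1.-homog.
Hypothesis GlM : forall m q, (M <= m)%N -> q \is m.-homog ->
  ideal_gen (G `|` [set l]) q.

Local Notation I := (ideal_gen G).
Local Notation B := (ideal_gen (G `|` [set l - 1])).
Local Notation pih := (pihomog mdeg).

Let II : is_ideal I := ideal_genP G.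
Let IB : is_ideal B := ideal_genP _.

Lemma dehomog_sub q : I q -> B q.
Proof. by apply: ideal_gen_mono => g Gg; apply: ideal_gen_in; left. Qed.

Lemma dehomog_l1 : B (l - 1).
Proof. by apply: ideal_gen_in; right. Qed.

Lemma dehomog_exp k q : B (l ^+ k * q - q).
Proof.
rewrite -{2}(mul1r q) -mulrBl; apply: (ideal_mulr IB); rewrite subrX1.
exact: (ideal_mulr IB _ dehomog_l1).
Qed.

Lemma divide_l m q : (M <= m)%N -> q \is m.+1.-homog ->
  exists2 q', q' \is m.-homog & I (q - l * q').
Proof.
move=> Mm qm; have /ideal_genU1[y [s [Iy qE]]] := GlM (leqW Mm) qm.
exists (pih m s); first exact: pihomogP.
rewrite -(pihomog_dE qm) {1}qE linearD /= -[X in pih X (s * l)]addn1.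
by rewrite (pihomogMr _ _ l1) mulrC addrK; apply: ideal_gen_pihomog.
Qed.

Lemma divide_lX k m q : (M <= m)%N -> q \is (m + k).-homog ->
  exists2 q', q' \is m.-homog & I (q - l ^+ k * q').
Proof.
move=> Mm; elim: k q => [|k IH] q; rewrite ?addn0 ?addnS => qm.
  by exists q; rewrite ?expr0 ?mul1r ?subrr //; apply: ideal_zero II.
have [u /IH[v vm Iv] Iu] := divide_l (leq_trans Mm (leq_addr k m)) qm.
exists v => //; have -> : q - l ^+ k.+1 * v = (q - l * u) + l * (u - l ^+ k * v).
  by rewrite exprS; ring.
by apply: (ideal_add II) => //; apply: (ideal_mull II).
Qed.

(** Homogenizing raises the degree, and in degrees at least [M] the superfluous
    powers of [l] can be divided out again. *)
Lemma dehomog_lift m q : (M <= m)%N ->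
  exists2 q', q' \is m.-homog & B (q - q').
Proof.
move=> Mm; pose k := msize q.
have hq : homogenize l (m + k) q \is (m + k).-homog by apply: homogenizeP.
have [q' q'm Iq'] := divide_lX Mm hq; exists q' => //.
have -> : q - q' = (homogenize l (m + k) q - l ^+ k * q') + (l ^+ k * q' - q')
    - (homogenize l (m + k) q - q).
  by move: (homogenize l _ q) (l ^+ k * q') => h r; ring.
apply: (ideal_sub IB); last first.
  by apply: (homogenize_mod IB dehomog_l1); rewrite leqW ?leq_addl.
by apply: (ideal_add IB); [apply: dehomog_sub|apply: dehomog_exp].
Qed.

(** Homogenizing a multiple of [l - 1] gives a telescoping sum. *)
Lemma dehomog_homogenize q :
  B q -> exists k0, forall k, (k0 <= k)%N -> I (homogenize l k q).
Proof.
move=> /ideal_genU1[y [s [Iy ->]]]; exists (msize s) => k sk.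
by rewrite linearD /= homogenizeM // addr0; apply: homogenize_ideal.
Qed.

Let N := #|{: 'X_{1..n < M.+1}}|.
Let e (i : 'I_N) : {mpoly K[n]} := 'X_[bmnm (enum_val i)].

Let eP q : q \is M.-homog -> exists c : 'I_N -> K, q = \sum_i c i *: e i.
Proof.
move=> qM; have sq : (msize q <= M.+1)%N.
  by rewrite msizeE; apply/bigmax_leqP_seq => m /(dhomog_mf qM) ->.
exists (fun i => q@_(bmnm (enum_val i))).
by rewrite [LHS](mpolywE sq) (reindex _ (onW_bij _ (enum_val_bij _))).
Qed.

Lemma dehomog_span : spans_mod e setT B.
Proof.
move=> q _; have [q' /eP[c ->] Bq] := dehomog_lift q (leqnn M).
by exists c.
Qed.

(** The powers of a coordinate are dependent modulo [l = 1], and the resulting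
    univariate polynomial splits. *)
Lemma dehomog_algebraic : coords_algebraic B.
Proof.
move=> j; pose v (i : 'I_N.+1) : {mpoly K[n]} := 'X_j ^+ i.
have SB := ideal_subspace IB.
have [c [i ci] Bc] :=
  spans_mod_dep (v := v) SB dehomog_span (fun=> Logic.I) (ltnSn N).
pose P : {poly K} := \poly_(i < N.+1) c (inord i).
have P0 : P != 0.
  apply: contraNneq ci => /(congr1 (fun q : {poly K} => q`_i)).
  by rewrite coef_poly ltn_ord inord_val coef0 => ->.
have BP : B (horner_alg 'X_j P).
  rewrite /P poly_def raddf_sum /= (eq_bigr (fun k => c k *: v k)) // => k _.
  by rewrite linearZ /= rmorphXn /= horner_algX inord_val mulr_algl.
have [r Pr] := closed_field_poly_normal P; exists r.
rewrite -lead_coef_eq0 in P0; move: BP; rewrite Pr linearZ /= mulr_algl rmorph_prod /=.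
move=> /(ideal_mpolyZ IB (lead_coef P)^-1); rewrite scalerA mulVf // scale1r.
rewrite (eq_bigr (fun z => 'X_j - z%:MP)) // => z _.
by rewrite rmorphB /= horner_algX horner_algC alg_mpolyC.
Qed.

(** The kernels of the powers of [l] on the forms of degree [M] form an
    ascending chain in a finite dimensional space, and every form of higher
    degree is one of degree [M] times a power of [l]; hence multiplication by
    [l] is eventually injective modulo [I]. *)
Lemma dehomog_inj : exists m0, forall m q, (m0 <= m)%N -> q \is m.-homog ->
  B q -> I q.
Proof.
(* the components of degree [M] of the combinations of monomials of degree at
   most [M] are all the forms of degree [M] *)
pose V (c : 'rV[K]_N) := pih M (\sum_i c 0 i *: e i).
have VL a c d : V (a *: c + d) = a *: V c + V d.
  rewrite /V -linearP /= scaler_sumr -big_split /=; congr (pih M _).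
  by apply: eq_bigr => i _; rewrite !mxE scalerDl scalerA.
pose U s := [set c : 'rV[K]_N | I (l ^+ s * V c)].
have SU s : is_subspace (U s).
  split=> [|a c d Uc Ud]; rewrite /U /=.
    have -> : V 0 = 0 by rewrite /V big1 ?linear0 // => i _; rewrite mxE scale0r.
    by rewrite mulr0; apply: ideal_zero II.
  rewrite VL mulrDr -scalerAr; apply: (ideal_add II) => //.
  exact: (ideal_mpolyZ II).
have Uinc s : U s `<=` U s.+1.
  by move=> c Uc; rewrite /U /= exprS -mulrA; apply: (ideal_mull II).
have [s0 Us0] := subspace_acc SU Uinc.
exists (M + s0)%N => m q mM qm Bq.
have mk : m = (M + (m - M))%N by rewrite subnKC // (leq_trans (leq_addr _ _) mM).
have [q' /[dup] q'M /eP[c q'c]] :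
    exists2 q', q' \is M.-homog & I (q - l ^+ (m - M) * q').
  by apply: divide_lX; rewrite -?mk.
set k := (m - M)%N in mk *; move=> Iq.
have q'V : q' = V (\row_i c i).
  rewrite /V -{1}(pihomog_dE q'M) q'c; congr (pih M _).
  by apply: eq_bigr => i _; rewrite mxE.
apply: (ideal_subK II Iq).
have mono s t : (s <= t)%N -> U s `<=` U t.
  move=> st x Ux; rewrite /U /= -(subnK st) exprD -mulrA.
  exact: (ideal_mull II).
rewrite q'V; apply: (mono s0 k).
  by rewrite /k leq_subRL // (leq_trans _ mM) ?leq_addr.
have [k0 Ik0] := dehomog_homogenize Bq.
pose t := (maxn k0 m)%N.
have It : I (l ^+ (t - m) * q).
  rewrite -(homogenize_homog l qm) ?leq_maxr //.
  by apply: Ik0; rewrite leq_maxl.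
apply: (Us0 (t - m + k)%N); rewrite /U /= -q'V exprD -mulrA.
have -> : l ^+ (t - m) * (l ^+ k * q') =
    l ^+ (t - m) * q - l ^+ (t - m) * (q - l ^+ k * q').
  by ring.
by apply: (ideal_sub II) => //; apply: (ideal_mull II).
Qed.

End Stable.

(** Induction on the number of coordinates that may be nonzero.  By the induction
    hypothesis the next coordinate [x_k] can be divided by in high degree; where
    [x_k = 1] there is no common zero, so 1 lies in the dehomogenized ideal, which
    in high degree is the given one. *)
Lemma projective_nullstellensatz (K : closedFieldType) n (G : set {mpoly K[n]}) :
    homog_set G ->
    (forall x : 'I_n -> K, (forall g, G g -> g.@[x] = 0) -> forall j, x j = 0) ->
  exists M, forall m q, (M <= m)%N -> q \is m.-homog -> ideal_gen G q.
Proof.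
move=> Ghom noz.
pose H k := G `|` [set g | exists2 j : 'I_n, (k <= j)%N & g = 'X_j].
have Hhom k : homog_set (H k).
  move=> g [/Ghom //|[j _ ->]]; exists 1%N; rewrite dhomogX; exact/eqP/mdeg1.
suff main k : (k <= n)%N -> exists M, forall m q, (M <= m)%N -> q \is m.-homog ->
    ideal_gen (H k) q.
  have [M HM] := main n (leqnn n); exists M => m q /HM /[apply].
  apply: ideal_gen_mono => g [/ideal_gen_in //|[j]].
  by rewrite leqNgt ltn_ord.
elim: k => [_|k IH kn].
  exists 1%N => m q m1 /dhomog_mf qm; rewrite [q]mpolyE big_seq_cond.
  apply: (ideal_sum (ideal_genP _)) => u; rewrite andbT => /qm um.
  apply: (ideal_mpolyZ (ideal_genP _)).
  have : mdeg u != 0%N by rewrite um -lt0n.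
  rewrite mdeg_eq0 => /mnm_neq0[j uj].
  rewrite -(mnm_subUK uj) mpolyXD; apply: (ideal_mull (ideal_genP _)).
  by apply: ideal_gen_in; right; exists j.
have [M HM] := IH (ltnW kn); pose j0 := Ordinal kn.
have X1 : ('X_j0 : {mpoly K[n]}) \is 1.-homog by rewrite dhomogX; apply/eqP/mdeg1.
have HkM m q : (M <= m)%N -> q \is m.-homog -> ideal_gen (H k.+1 `|` [set 'X_j0]) q.
  move=> /HM /[apply]; apply: ideal_gen_mono => g [Gg|[j kj ->]].
    by apply: ideal_gen_in; left; left.
  move: kj; rewrite leq_eqVlt => /orP[/eqP kj|kj]; apply: ideal_gen_in.
    by right; congr 'X_(_); apply: val_inj.
  by left; right; exists j.
have [m0 m0P] := dehomog_inj (Hhom _) X1 HkM; exists m0 => m q /m0P /[apply]; apply.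
rewrite -(mulr1 q); apply: (ideal_mull (ideal_genP _)).
have Halg := dehomog_algebraic (Hhom _) X1 HkM.
apply: nullstellensatz_fin (ideal_genP _) Halg _ => x xz.
have : ('X_j0 - 1 : {mpoly K[n]}).@[x] = 0 by apply: xz; apply: ideal_gen_in; right.
rewrite mevalB mevalXU meval1 noz ?sub0r => [/eqP|g Gg].
  by rewrite oppr_eq0 oner_eq0.
by apply: xz; apply: ideal_gen_in; left; left.
Qed.

(** * Decomposition along the zeros *)

(** The polynomials that vanish in the quotient of the local ring at [x] by the
    extension of [B]. *)
Definition local_ideal (K : fieldType) n (B : set {mpoly K[n]}) (x : 'I_n -> K)
    : set {mpoly K[n]} :=
  [set q | exists2 E, E.@[x] != 0 & B (E * q)].

Section LocalIdeal.
Variables (K : closedFieldType) (n : nat) (B : set {mpoly K[n]}).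
Hypothesis IB : is_ideal B.

Lemma local_idealP x : is_ideal (local_ideal B x).
Proof.
split=> [|q r [E Ex Eq] [F Fx Fr]|a q [E Ex Eq]].
- by exists 1; rewrite ?meval1 ?oner_eq0 // mulr0; apply: ideal_zero IB.
- exists (E * F); first by rewrite mevalM mulf_neq0.
  have -> : E * F * (q + r) = F * (E * q) + E * (F * r) by ring.
  by apply: (ideal_add IB); apply: (ideal_mull IB).
- by exists E => //; rewrite mulrCA; apply: (ideal_mull IB).
Qed.

Lemma local_ideal_sub x : B `<=` local_ideal B x.
Proof. by move=> q Bq; exists 1; rewrite ?meval1 ?oner_eq0 ?mul1r. Qed.

(** The factors of a split annihilator of a coordinate that do not vanish at
    [x] are units there. *)
Lemma local_ideal_nilpotent x j : coords_algebraic B ->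
  exists D, local_ideal B x (('X_j - (x j)%:MP) ^+ D).
Proof.
move=> /(_ j)[r Br].
pose E := \prod_(z <- r | z != x j) ('X_j - z%:MP) : {mpoly K[n]}.
have [D rE] : exists D,
    \prod_(z <- r | z == x j) ('X_j - z%:MP) = ('X_j - (x j)%:MP : {mpoly K[n]}) ^+ D.
  apply: (big_ind (fun y : {mpoly K[n]} => exists D, y = ('X_j - (x j)%:MP) ^+ D)).
  - by exists 0%N; rewrite expr0.
  - by move=> _ _ [D1 ->] [D2 ->]; exists (D1 + D2)%N; rewrite exprD.
  - by move=> z /eqP ->; exists 1%N.
exists D; exists E; last by move: Br; rewrite (bigID (pred1 (x j))) /= rE mulrC.
apply: (big_ind (fun y : {mpoly K[n]} => y.@[x] != 0)).
- by rewrite meval1 oner_eq0.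
- by move=> y z yx zx; rewrite mevalM mulf_neq0.
- by move=> z zx; rewrite mevalB mevalXU mevalC subr_eq0 eq_sym.
Qed.

Variables (p : nat) (x : 'I_p -> 'I_n -> K).
Hypothesis Balg : coords_algebraic B.
Hypothesis Bzeros : forall y, (forall q, B q -> q.@[y] = 0) -> exists i, y = x i.

Lemma comaximal (C : set {mpoly K[n]}) : is_ideal C -> B `<=` C ->
  (forall i, exists2 E, C E & E.@[x i] != 0) -> C 1.
Proof.
move=> IC BC CE; apply: nullstellensatz_fin IC _ _ => [j|y Cy].
  by have [r /BC] := Balg j; exists r.
have [i yx] : exists i, y = x i by apply: Bzeros => q /BC /Cy.
by have [E /Cy] := CE i; rewrite yx => ->; rewrite eqxx.
Qed.

(** The ideal of the multipliers of [q] into [B] has no zero. *)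
Lemma local_ideal_cap q : (forall i, local_ideal B (x i) q) -> B q.
Proof.
move=> lq; rewrite -(mul1r q).
apply: (@comaximal [set s | B (s * q)]).
- split=> [|s t|a s] /=; first by rewrite mul0r; apply: ideal_zero IB.
    by rewrite mulrDl; apply: ideal_add IB _ _.
  by rewrite -mulrA; apply: ideal_mull IB _ _.
- by move=> s Bs; apply: (ideal_mulr IB).
- by move=> i; have [E] := lq i; exists E.
Qed.

(** Chinese remainder theorem: powers of the differences of coordinates vanish
    at all points but one, and together they are comaximal. *)
Lemma local_ideal_idempotent : injective x ->
  exists eps : 'I_p -> {mpoly K[n]}, forall i,
    local_ideal B (x i) (1 - eps i) /\
    forall j, j != i -> local_ideal B (x j) (eps i).
Proof.
move=> xinj.
have sep i j : exists2 E : {mpoly K[n]},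
    j != i -> local_ideal B (x j) E & E.@[x i] != 0.
  have [->|ji] := eqVneq j i; first by exists 1; rewrite ?meval1 ?oner_eq0.
  have [k xk] : exists k, x i k != x j k.
    apply: contrapT => nk; move/eqP: ji; apply; apply: xinj; apply: funext => k.
    by apply: contrapT => /eqP; rewrite eq_sym => xk; apply: nk; exists k.
  have [D lD] := local_ideal_nilpotent (x j) k Balg.
  exists (('X_k - (x j k)%:MP) ^+ D) => //.
  by rewrite rmorphXn /= mevalB mevalXU mevalC expf_neq0 // subr_eq0.
have /choice[F FP] i : exists F : {mpoly K[n]},
    (forall j, j != i -> local_ideal B (x j) F) /\ F.@[x i] != 0.
  have /choice[E EP] j : exists E : {mpoly K[n]},
      (j != i -> local_ideal B (x j) E) /\ E.@[x i] != 0.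
    by have [E] := sep i j; exists E.
  exists (\prod_j E j); split=> [j ji|].
    rewrite (bigD1 j) //=; apply: (ideal_mulr (local_idealP _)).
    exact: (EP j).1.
  by rewrite rmorph_prod /=; apply/prodf_neq0 => j _; apply: (EP j).2.
have : [set q | exists s : 'I_p -> {mpoly K[n]}, B (q - \sum_i s i * F i)] 1.
  apply: comaximal => [|q Bq|i] /=.
  - split=> [|q r [s Bs] [t Bt]|a q [s Bs]] /=.
    + exists (fun=> 0); rewrite big1 ?subr0; first exact: ideal_zero IB.
      by move=> i _; rewrite mul0r.
    + exists (fun i => s i + t i).
      under eq_bigr do rewrite mulrDl.
      by rewrite big_split /= opprD addrACA; apply: (ideal_add IB).
    + exists (fun i => a * s i).
      under eq_bigr do rewrite -mulrA.
      by rewrite -mulr_sumr -mulrBr; apply: (ideal_mull IB).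
  - by exists (fun=> 0); rewrite big1 ?subr0 // => i _; rewrite mul0r.
  - exists (F i); last exact: (FP i).2.
    exists (fun j => (j == i)%:R).
    rewrite (bigD1 i) //= eqxx mul1r big1 ?addr0 ?subrr.
      exact: ideal_zero IB.
    by move=> j /negbTE ->; rewrite mul0r.
move=> [s Bs]; exists (fun i => s i * F i) => i.
have lF j k : k != j -> local_ideal B (x k) (s j * F j).
  by move=> kj; apply: (ideal_mull (local_idealP _)); apply: (FP j).1.
split=> [|j]; last exact: lF.
have -> : 1 - s i * F i = (1 - \sum_j s j * F j) + \sum_(j | j != i) s j * F j.
  by rewrite (bigD1 i) //= opprD addrA subrK.
apply: (ideal_add (local_idealP _)); first exact: local_ideal_sub.
by apply: (ideal_sum (local_idealP _)) => j ji; apply: lF; rewrite eq_sym.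
Qed.

End LocalIdeal.

(** On the form with coefficients [t ^ j], nonvanishing at a given point is the
    nonvanishing at [t] of a nonzero polynomial; some natural number [t] avoids the
    roots of all of these. *)
Lemma linear_form_avoiding (K : numClosedFieldType) n p (a : 'I_p -> 'I_n -> K) :
    (forall i, exists j, a i j != 0) ->
  exists2 l : {mpoly K[n]}, l \is 1.-homog & forall i, l.@[a i] != 0.
Proof.
move=> a0.
pose P i : {poly K} := \poly_(j < n) (if insub j is Some k then a i k else 0).
have PE i t : (P i).[t] = \sum_(j < n) a i j * t ^+ j.
  rewrite horner_poly; apply: eq_bigr => j _; congr (_ * _).
  by rewrite insubT //= => jn; congr (a i _); apply: val_inj.
have P0 i : P i != 0.
  have [j aij] := a0 i; apply: contraNneq aij => /(congr1 (fun q : {poly K} => q`_j)).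
  rewrite coef_poly ltn_ord coef0 insubT //= => jn /eqP.
  by congr (a i _ == 0); apply: val_inj.
pose Q := \prod_i P i; have Q0 : Q != 0 by apply/prodf_neq0.
have [t Qt] : exists t : nat, ~~ root Q t%:R.
  apply: contrapT => nt; pose s := [seq (t%:R : K) | t <- iota 0 (size Q)].
  have : (size s < size Q)%N.
    apply: max_poly_roots => //.
      apply/allP => _ /mapP[t _ ->]; apply: contrapT => /negP ?; apply: nt.
      by exists t.
    rewrite map_inj_uniq ?iota_uniq // => u v /eqP; rewrite eqr_nat => /eqP //.
  by rewrite size_map size_iota ltnn.
exists (\sum_(j < n) t%:R ^+ j *: 'X_j).
  by apply: rpred_sum => j _; apply: rpredZ; rewrite dhomogX; apply/eqP/mdeg1.
move=> i; rewrite raddf_sum /=.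
under eq_bigr do rewrite mevalZ mevalXU mulrC.
rewrite -PE; apply: contra Qt => Pt; rewrite /Q (bigD1 i) //= rootM.
by rewrite /root Pt.
Qed.

(** * The Hilbert function of an ideal with finitely many zeros *)

Section HilbertFunction.
Variables (K : closedFieldType) (n p : nat).
Variables (G : set {mpoly K[n]}) (l : {mpoly K[n]}) (x : 'I_p -> 'I_n -> K).
Hypothesis Ghom : homog_set G.
Hypothesis l1 : l \is 1.-homog.
Hypothesis lx : forall i, l.@[x i] = 1.
Hypothesis xinj : injective x.
Hypothesis Gzeros : forall y, (exists j, y j != 0) -> (forall g, G g -> g.@[y] = 0) ->
  exists i c, forall j, y j = c * x i j.

Local Notation I := (ideal_gen G).
Local Notation B := (ideal_gen (G `|` [set l - 1])).

Let IB : is_ideal B := ideal_genP _.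

Let l_generates : exists M, forall m q, (M <= m)%N -> q \is m.-homog ->
  ideal_gen (G `|` [set l]) q.
Proof.
apply: projective_nullstellensatz => [g [/Ghom //|->]|y yz j]; first by exists 1%N.
apply: contrapT => /eqP yj.
have [|i [c yE]] := Gzeros (ex_intro _ j yj); first by move=> g Gg; apply: yz; left.
have : l.@[y] = 0 by apply: yz; right.
rewrite (meval_eq l yE) (meval_homog _ _ l1) lx expr1 mulr1 => c0.
by move/eqP: yj; rewrite yE c0 mul0r.
Qed.

Let Bzeros y : (forall q, B q -> q.@[y] = 0) -> exists i, y = x i.
Proof.
move=> By; have ly : l.@[y] = 1.
  apply/eqP; rewrite -subr_eq0 -(meval1 y) -mevalB; apply/eqP/By.
  by apply: ideal_gen_in; right.
have [||i [c yE]] := Gzeros (y := y).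
- apply: contrapT => y0; have y0' j : y j = 0 * y j.
    by rewrite mul0r; apply: contrapT => /eqP ?; apply: y0; exists j.
  move/eqP: ly; rewrite (meval_eq l y0') (meval_homog _ _ l1) mul0r eq_sym.
  by rewrite oner_eq0.
- by move=> g Gg; apply: By; apply: ideal_gen_in; left.
exists i; apply: funext => j; rewrite yE.
move: ly; rewrite (meval_eq l yE) (meval_homog _ _ l1) lx expr1 mulr1 => ->.
by rewrite mul1r.
Qed.

Lemma affine_algebraic : coords_algebraic B.
Proof. by have [M] := l_generates; apply: dehomog_algebraic. Qed.

Lemma local_quot_dim i : exists d, quot_dim setT (local_ideal B (x i)) d.
Proof.
have [M HM] := l_generates.
apply: quot_dim_exists (ideal_subspace (local_idealP IB (x i))) (fun=> Logic.I) _.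
exact: spans_modS (local_ideal_sub _) (dehomog_span Ghom l1 HM).
Qed.

(** In high degree, forms modulo [I] are polynomials modulo [l = 1], and these
    split as the product of the local quotients at the zeros. *)
Theorem hilbert_function_local (chi : 'I_p -> nat) :
    (forall i, quot_dim setT (local_ideal B (x i)) (chi i)) ->
  exists m0, forall m, (m0 <= m)%N ->
    quot_dim [set q : {mpoly K[n]} | q \is m.-homog] I (\sum_(i < p) chi i).
Proof.
move=> chiP; have [M HM] := l_generates.
have Balg := affine_algebraic.
have [eps epsP] := local_ideal_idempotent IB Balg Bzeros xinj.
have [m1 m1P] := dehomog_inj Ghom l1 HM.
exists (maxn M (m1)) => m; rewrite geq_max => /andP[Mm mm1].
have inj q : q \is m.-homog -> B q -> I q by apply: m1P mm1.
pose T := {i : 'I_p & 'I_(chi i)}.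
have <- : #|{: T}| = (\sum_(i < p) chi i)%N.
  rewrite card_tagged sumnE big_map big_enum /=.
  by apply: eq_bigr => i _; rewrite card_ord.
have exe i : exists e : 'I_(chi i) -> {mpoly K[n]},
    (forall q, exists c : 'I_(chi i) -> K,
       local_ideal B (x i) (q - \sum_t c t *: e t)) /\
    (forall c : 'I_(chi i) -> K, local_ideal B (x i) (\sum_t c t *: e t) ->
       forall t, c t = 0).
  by have [e [_ span indep]] := chiP i; exists e; split=> // q; apply: span.
pose e i := sval (cid (exe i)); have eP i := svalP (cid (exe i)); rewrite -/(e _) in eP.
have /choice[b bP] (t : T) : exists b : {mpoly K[n]}, b \is m.-homog /\
    B (eps (tag t) * e _ (tagged t) - b).
  by have [b] := dehomog_lift Ghom l1 HM (eps (tag t) * e _ (tagged t)) Mm; exists b.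
pose D (c : T -> K) i := \sum_(t < chi i) c (Tagged _ t) *: e i t.
have sumT (c : T -> K) :
    \sum_t c t *: (eps (tag t) * e _ (tagged t)) = \sum_i eps i * D c i.
  under [RHS]eq_bigr do rewrite mulr_sumr.
  rewrite sig_big_dep /=; apply: eq_bigr => -[i t] _ /=.
  by rewrite -scalerAr.
have key (c : T -> K) j : local_ideal B (x j) (D c j - \sum_t c t *: b t).
  have Lj := local_idealP IB (x j).
  have -> : D c j - \sum_t c t *: b t =
      (1 - eps j) * D c j - \sum_(i | i != j) eps i * D c i
      + \sum_t c t *: (eps (tag t) * e _ (tagged t) - b t).
    rewrite [in RHS](eq_bigr _ (fun t _ => scalerBr (c t) _ _)).
    rewrite sumrB sumT [X in _ + (X - _)](bigD1 j) //=.
    by move: (\sum_(i | _) _) (\sum_t _) (D c j) => u v w; ring.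
  apply: (ideal_add Lj); last first.
    apply: (ideal_sum Lj) => t _; apply/(ideal_mpolyZ Lj)/local_ideal_sub.
    exact: (bP t).2.
  apply: (ideal_sub Lj); first by apply: (ideal_mulr Lj); apply: (epsP j).1.
  apply: (ideal_sum Lj) => i ij; apply: (ideal_mulr Lj); apply: (epsP i).2.
  by rewrite eq_sym.
have bm (c : T -> K) : \sum_t c t *: b t \is m.-homog.
  by apply: rpred_sum => t _; apply/rpredZ/(bP t).1.
apply: (quot_dim_fin (b := b)) => [t|q qm|c Ic [j t]]; first exact: (bP t).1.
  pose c i := sval (cid ((eP i).1 q)); have cP i := svalP (cid ((eP i).1 q)).
  pose c' (t : T) := c (tag t) (tagged t).
  exists c'; apply: inj; first exact: (rpredB qm (bm _)).
  apply: (local_ideal_cap IB Balg Bzeros) => j.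
  have := ideal_add (local_idealP IB (x j)) (cP j) (key c' j).
  by rewrite /D /= addrA subrK.
apply: ((eP j).2 (fun t => c (Tagged _ t))).
apply: (ideal_subK (local_idealP IB (x j)) (key c j)).
exact/local_ideal_sub/dehomog_sub.
Qed.

End HilbertFunction.

(** * Germs of analytic functions *)

Section Series.
Variables (n : nat) (K : comNzRingType).
Implicit Types (a b : mseries n K) (m k : 'X_{1..n}).

Lemma mseries_addE a b m : (a + b) m = a m + b m. Proof. by []. Qed.

Lemma mseries1E m : (1 : mseries n K) m = (m == 0%MM)%:R. Proof. by []. Qed.

Lemma mseries_mul_def a b m : (a * b) m =
  \sum_(k : 'X_{1..n < (mdeg m).+1, (mdeg m).+1} | m == (k.1 + k.2)%MM) a k.1 * b k.2.
Proof. by []. Qed.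

Lemma mseries_mul_ext a b a' b' m :
    (forall k, (mdeg k <= mdeg m)%N -> a k = a' k) ->
    (forall k, (mdeg k <= mdeg m)%N -> b k = b' k) ->
  (a * b) m = (a' * b') m.
Proof.
by move=> aa bb; apply: eq_bigr => k _; rewrite aa ?bb // -ltnS; apply: bmdeg.
Qed.

Definition mseries_trunc d a : {mpoly K[n]} := \sum_(m : 'X_{1..n < d}) a m *: 'X_[m].

Lemma mseries_mul_trunc d a b m : (mdeg m < d)%N ->
  (a * b) m = (mseries_trunc d a * mseries_trunc d b)@_m.
Proof.
move=> md; apply: mseries_mul_mcoeff => k km.
  by rewrite mcoeff_mpoly // (leq_ltn_trans km).
by rewrite mcoeff_mpoly // (leq_ltn_trans km).
Qed.

Lemma mseries_derivM i a b :
  mseries_deriv i (a * b) = mseries_deriv i a * b + a * mseries_deriv i b.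
Proof.
apply/funext => m; have md : (mdeg (m + U_(i)) < (mdeg m).+2)%N.
  by rewrite mdegD mdeg1 addn1.
rewrite /mseries_deriv (mseries_mul_trunc _ _ md) mulr_natl -mcoeff_deriv.
rewrite mderivM mcoeffD.
have tr (c : mseries n K) k : (mdeg k <= mdeg m)%N ->
    (mseries_trunc (mdeg m).+2 c)@_k = c k.
  by move=> km; rewrite mcoeff_mpoly // ltnS leqW.
have trD (c : mseries n K) k : (mdeg k <= mdeg m)%N ->
    (mseries_trunc (mdeg m).+2 c)^`M(i)@_k = mseries_deriv i c k.
  move=> km; rewrite mcoeff_deriv mcoeff_mpoly; first by rewrite -mulr_natl.
  by rewrite mdegD mdeg1 addn1 !ltnS.
congr (_ + _); symmetry; apply: mseries_mul_mcoeff; by [apply: trD|apply: tr].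
Qed.

Lemma mcoeffXUM (q : {mpoly K[n]}) i m :
  ('X_i * q)@_m = if m i == 0%N then 0 else q@_(m - U_(i)).
Proof.
case: eqP => [mi|/eqP mi]; last first.
  by rewrite -commr_mpolyX -[in LHS](mnm_subUK mi) addmC mcoeffMX.
elim/mpolyind: q => [|c k q _ _ IH]; first by rewrite mulr0 mcoeff0.
rewrite mulrDr mcoeffD IH addr0 -scalerAr mcoeffZ -mpolyXD mcoeffX.
case: eqP => [km|_]; last by rewrite mulr0.
by move: mi; rewrite -km mnmDE mnm1E eqxx.
Qed.

Lemma mseries_XUM i a m :
  (((fun k => (k == U_(i)%MM)%:R) : mseries n K) * a) m =
  if m i == 0%N then 0 else a (m - U_(i))%MM.
Proof.
transitivity ('X_i * mseries_trunc (mdeg m).+1 a)@_m.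
  apply: mseries_mul_mcoeff => k km; first by rewrite mcoeffX eq_sym.
  by rewrite mcoeff_mpoly.
rewrite mcoeffXUM; case: ifP => // _.
by rewrite mcoeff_mpoly // ltnS mdegB.
Qed.

(** This is the [N]-th power of the ideal of the series without constant term. *)
Definition vanish N a : Prop := forall m, (mdeg m < N)%N -> a m = 0.

Lemma vanishM N N' a b : vanish N a -> vanish N' b -> vanish (N + N') (a * b).
Proof.
move=> va vb m mN; rewrite mseries_mul_def big1 // => k /eqP mk.
have [/va -> |Nk] := ltnP (mdeg k.1) N; first by rewrite mul0r.
rewrite vb ?mulr0 // -(ltn_add2l N); apply: leq_ltn_trans mN.
by apply: leq_trans (eq_leq (esym (congr1 mdeg mk))); rewrite mdegD leq_add2r.
Qed.

Lemma vanishX N a : vanish 1 a -> vanish N (a ^+ N).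
Proof.
move=> va; elim: N => [|N IH]; first by move=> m; rewrite ltn0.
by rewrite exprS -add1n; apply: vanishM.
Qed.

Lemma vanish_ideal N : is_ideal (vanish N).
Proof.
split=> [m //|a b va vb m mN|a b vb].
  by rewrite mseries_addE va ?vb ?addr0.
by rewrite -(add0n N); apply: vanishM.
Qed.

Lemma vanish_deriv N i a : vanish N.+1 a -> vanish N (mseries_deriv i a).
Proof.
move=> va m mN; rewrite /mseries_deriv va ?mulr0 //.
by rewrite mdegD mdeg1 addn1 ltnS.
Qed.

(** The sum of all powers of [a], when [a] has no constant term: the powers beyond
    the degree of a monomial do not contain it. *)
Definition mseries_geom a : mseries n K :=
  fun m => (\sum_(k < (mdeg m).+1) a ^+ k) m.

Lemma mseries_sumE (I : Type) (r : seq I) (P : pred I) (F : I -> mseries n K) m :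
  (\sum_(i <- r | P i) F i) m = \sum_(i <- r | P i) F i m.
Proof. by apply: (big_morph (fun a : mseries n K => a m)). Qed.

Lemma mseries_geomE a m : vanish 1 a ->
  mseries_geom a m = (1 + a * mseries_geom a) m.
Proof.
move=> va; pose S := \sum_(k < (mdeg m).+1) a ^+ k.
have geomS k : (mdeg k <= mdeg m)%N -> mseries_geom a k = S k.
  move=> km; rewrite /mseries_geom /S !mseries_sumE.
  rewrite -(subnKC km) -addSn big_split_ord /= [X in _ = _ + X]big1 ?addr0 // => i _.
  by apply: (vanishX va); rewrite addSn ltnS leq_addr.
have -> : (1 + a * mseries_geom a) m = (1 + a * S) m.
  rewrite !mseries_addE; congr (_ + _).
  exact: mseries_mul_ext.
have -> : 1 + a * S = S + a ^+ (mdeg m).+1.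
  transitivity (\sum_(k < (mdeg m).+2) a ^+ k); last by rewrite big_ord_recr.
  rewrite big_ord_recl expr0 mulr_sumr; congr (1 + _).
  by apply: eq_bigr => k _; rewrite -exprS.
by rewrite mseries_addE (vanishX va) ?addr0 // geomS.
Qed.

End Series.

Section Convergence.
Variables (n : nat) (K : numFieldType).
Implicit Types (a b : mseries n K) (r M : K).

Lemma card_bmultinom_le1 d (k : 'X_{1..n}) :
  (#|[pred m : 'X_{1..n < d} | bmnm m == k]| <= 1)%N.
Proof.
apply/card_le1_eqP => x y; rewrite !inE => /eqP xk /eqP yk.
by apply: val_inj; rewrite /= xk yk.
Qed.

Lemma convergent_dominated a b :
  (forall m, `|b m| <= `|a m|) -> convergent a -> convergent b.
Proof.
move=> ba [r [M [r0 Ma]]]; exists r, M; split=> // d; apply: le_trans (Ma d).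
by apply: ler_sum => m _; rewrite ler_wpM2r ?exprn_ge0 // ltW.
Qed.

Lemma convergent_monomial (k : 'X_{1..n}) :
  convergent (fun m : 'X_{1..n} => (m == k)%:R : K).
Proof.
exists 1, 1; split=> // d.
rewrite (eq_bigr (fun m : 'X_{1..n < d} => (bmnm m == k)%:R)); last first.
  by move=> m _; rewrite expr1n mulr1 normr_nat.
by rewrite -natr_sum lern1 -big_mkcond sum1_card card_bmultinom_le1.
Qed.

Definition psum r d a : K := \sum_(m : 'X_{1..n < d}) `|a m| * r ^+ mdeg m.

Lemma psum_ge0 r d a : 0 <= r -> 0 <= psum r d a.
Proof. by move=> r0; apply: sumr_ge0 => m _; rewrite mulr_ge0 ?exprn_ge0. Qed.

Lemma psumM r d a b : 0 <= r -> psum r d (a * b) <= psum r d a * psum r d b.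
Proof.
move=> r0; rewrite /psum big_distrlr pair_bigA /=.
set F := fun k : 'X_{1..n} * 'X_{1..n} =>
  `|a k.1| * r ^+ mdeg k.1 * (`|b k.2| * r ^+ mdeg k.2).
have F0 k : 0 <= F k by rewrite !mulr_ge0 ?exprn_ge0.
apply: (@le_trans _ _ (\sum_(m : 'X_{1..n < d})
    \sum_(k : 'X_{1..n < d, d} | bmnm m == (k.1 + k.2)%MM) F (bmnm k.1, bmnm k.2))).
  apply: ler_sum => m _; rewrite [(a * b) m](mseries_mulE _ _ (bmdeg m)).
  apply: le_trans (ler_wpM2r (exprn_ge0 _ r0) (ler_norm_sum _ _ _)) _.
  rewrite mulr_suml; apply: ler_sum => k /eqP ->.
  by rewrite normrM mdegD exprD mulrACA.
rewrite (exchange_big_dep predT) //=; apply: ler_sum => k _.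
by rewrite sumr_const -[leRHS]mulr1n ler_wpMn2l ?card_bmultinom_le1.
Qed.

Lemma psum1_add r d a : 0 <= r -> psum r d (1 + a) <= 1 + psum r d a.
Proof.
move=> r0; have p1 : psum r d 1 <= 1.
  rewrite /psum (eq_bigr (fun m : 'X_{1..n < d} => (bmnm m == 0%MM)%:R)); last first.
    move=> m _; rewrite mseries1E normr_nat.
    by case: eqP => [->|]; rewrite ?mdeg0 ?mulr1 ?mul0r.
  by rewrite -natr_sum lern1 -big_mkcond sum1_card card_bmultinom_le1.
apply: le_trans (lerD p1 (lexx _)); rewrite /psum -big_split /=.
apply: ler_sum => m _; rewrite -mulrDl ler_wpM2r ?exprn_ge0 //.
exact: ler_normD.
Qed.

(** On a polydisc so small that the partial sums of [a] are at most 1/2, those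
    of its geometric series [b = 1 + a * b] are at most 2. *)
Lemma convergent_geom a : vanish 1 a -> convergent a -> convergent (mseries_geom a).
Proof.
move=> va [r [M [r0 Ma]]].
have M0 : 0 <= M by apply: le_trans (Ma 0%N); apply: psum_ge0 (ltW r0).
(* shrinking the radius by [c] divides the sum of the nonconstant terms, at
   most [M], by at least [2 * (M + 1)] *)
pose c := (2 * (M + 1))^-1; have M1 : 0 < M + 1 by rewrite ltr_wpDl.
have c0 : 0 < c by rewrite invr_gt0 mulr_gt0.
have c1 : c <= 1.
  by rewrite invf_le1 ?mulr_gt0 // -[leLHS]mulr1 ler_pM // ?ler1n // lerDr.
have cM : c * M <= 2^-1.
  rewrite /c invfM -mulrA; apply: ler_piMr; first by rewrite invr_ge0.
  by rewrite ler_pdivrMl // mulr1 lerDl.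
exists (r * c), 2; split=> [|d]; first exact: mulr_gt0.
have rc0 : 0 <= r * c by rewrite ltW // mulr_gt0.
have half : psum (r * c) d a <= 2^-1.
  apply: le_trans cM; apply: le_trans (ler_wpM2l (ltW c0) (Ma d)).
  rewrite mulr_sumr; apply: ler_sum => m _.
  have [->|m0] := eqVneq (bmnm m) 0%MM.
    by rewrite va ?mdeg0 // normr0 !mul0r mulr0.
  rewrite mulrCA ler_wpM2l // exprMn mulrC ler_wpM2r ?exprn_ge0 ?(ltW r0) //.
  by apply: ler_iXnr; rewrite ?(ltW c0) // lt0n mdeg_eq0.
set b := mseries_geom a.
have bE : b = 1 + a * b by apply/funext => m; apply: mseries_geomE.
have : psum (r * c) d b <= 1 + 2^-1 * psum (r * c) d b.
  rewrite {1}bE; apply: le_trans (psum1_add _ _ rc0) _; rewrite lerD2l.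
  by apply: le_trans (psumM _ _ _ rc0) _; rewrite ler_wpM2r ?psum_ge0.
rewrite -lerBlDr -{1}(mul1r (psum _ _ _)) -mulrBl.
have -> : 1 - 2^-1 = 2^-1 :> K by field.
by rewrite ler_pdivrMl // mulr1.
Qed.

End Convergence.

#[local] Arguments germ_at0 : simpl never.
#[local] Arguments mpoly_germ : simpl never.

Section Germs.
Variables (n : nat) (K : numFieldType).
Implicit Types (g h : germ n K) (m : 'X_{1..n}).

Lemma germP g h : (germ_coef g = germ_coef h) -> g = h.
Proof. exact: val_inj. Qed.

Lemma germ_at0_is_zmod : zmod_morphism (@germ_at0 n K).
Proof. by []. Qed.

Lemma germ_at0_is_monoid : monoid_morphism (@germ_at0 n K).
Proof.
split=> [|g h]; first by have := @mseries1E n K 0%MM; rewrite eqxx.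
have := @mseries_mul_trunc n K 1 g h 0%MM; rewrite mdeg0 => /(_ isT).
rewrite /germ_at0 /= => ->; rewrite rmorphM /=.
by rewrite !mcoeff_mpoly ?mdeg0.
Qed.

HB.instance Definition _ :=
  GRing.isZmodMorphism.Build (germ n K) K (@germ_at0 n K) germ_at0_is_zmod.
HB.instance Definition _ :=
  GRing.isMonoidMorphism.Build (germ n K) K (@germ_at0 n K) germ_at0_is_monoid.

Lemma germ_at0Z c g : germ_at0 (c *: g) = c * germ_at0 g.
Proof. by []. Qed.

Lemma germ_at0A c : germ_at0 (c%:A : germ n K) = c.
Proof. by rewrite germ_at0Z rmorph1 mulr1. Qed.

Lemma germ_at0_sub g : germ_at0 (g - (germ_at0 g)%:A) = 0.
Proof. by rewrite rmorphB /= germ_at0A subrr. Qed.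

Lemma germ_deriv_is_linear i : linear (@germ_deriv n K i).
Proof.
move=> c g h; apply: germP; apply/funext => m.
rewrite /= /mseries_deriv [LHS]mulrDr; congr (_ + _).
by rewrite [LHS]mulrCA.
Qed.

HB.instance Definition _ i :=
  GRing.isLinear.Build K (germ n K) (germ n K) _ (@germ_deriv n K i)
    (germ_deriv_is_linear i).

Lemma germ_derivM i g h :
  germ_deriv i (g * h) = germ_deriv i g * h + g * germ_deriv i h.
Proof. by apply: germP; rewrite /= mseries_derivM. Qed.

Lemma germ_deriv1 i : germ_deriv i 1 = 0 :> germ n K.
Proof.
have := germ_derivM i 1 1; rewrite !mulr1 !mul1r => /eqP.
by rewrite -subr_eq0 opprD addrA subrr sub0r oppr_eq0 => /eqP.
Qed.

Lemma germ_derivA i c : germ_deriv i (c%:A) = 0 :> germ n K.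
Proof. by rewrite linearZ /= germ_deriv1 scaler0. Qed.

Lemma germ_deriv_comm i j g :
  germ_deriv i (germ_deriv j g) = germ_deriv j (germ_deriv i g).
Proof.
apply: germP; apply/funext => m; rewrite /= /mseries_deriv.
rewrite !mulrA -!addmA [(U_(i) + _)%MM]addmC; congr (_ * _).
rewrite !mnmDE !mnm1E; have [->//|ij] := eqVneq i j.
by rewrite !addn0 mulrC.
Qed.

Lemma germ_vanish1 g : vanish 1 g <-> germ_at0 g = 0.
Proof.
split=> [|g0 m]; first by apply; rewrite mdeg0.
by rewrite ltnS leqn0 mdeg_eq0 => /eqP ->.
Qed.

Lemma germ_vanish_ideal N : is_ideal [set g : germ n K | vanish N g].
Proof.
have [v0 vD vM] := vanish_ideal n K N.
by split=> [|g h|g h]; [exact: v0|exact: vD|exact: vM].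
Qed.

Lemma germ_inverse g : germ_at0 g != 0 -> exists h, g * h = 1.
Proof.
move=> g0; pose a := 1 - (germ_at0 g)^-1 *: g.
have va : vanish 1 a.
  by apply/germ_vanish1; rewrite /a rmorphB rmorph1 /= germ_at0Z mulVf ?subrr.
pose b := germ_of (convergent_geom va (germ_convergent a)).
have bE : b = 1 + a * b by apply: germP; apply/funext => m; apply: mseries_geomE.
exists ((germ_at0 g)^-1 *: b); rewrite -scalerAr scalerAl.
have -> : (germ_at0 g)^-1 *: g = 1 - a by rewrite /a opprB addrC subrK.
by rewrite mulrBl mul1r {1}bE addrK.
Qed.

Definition germ_var (i : 'I_n) : germ n K := germ_of (convergent_monomial K U_(i)%MM).

(** Hadamard's lemma: a monomial other than 1 is divided by the first variable
    that occurs in it. *)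
Lemma germ_hadamard g : germ_at0 g = 0 ->
  exists c : 'I_n -> germ n K, g = \sum_i germ_var i * c i
    /\ forall i, germ_at0 (c i) = germ_at0 (germ_deriv i g).
Proof.
move=> g0; pose first (i : 'I_n) m := [forall j : 'I_n, (j < i)%N ==> (m j == 0%N)].
(* a monomial divisible by several variables is assigned to the first one, so
   that it is counted once *)
pose cs (i : 'I_n) : mseries n K := fun k =>
  if first i k then germ_coef g (k + U_(i))%MM else 0.
have ccs i : convergent (cs i).
  apply: convergent_dominated (germ_convergent (germ_deriv i g)) => k.
  rewrite /cs /= /mseries_deriv normrM normr_nat.
  by case: ifP => _; rewrite ?normr0 ?mulr_ge0 // ler_peMl // ler1n.
exists (fun i => germ_of (ccs i)); split=> [|i]; last first.
  rewrite /germ_at0 /= /cs /mseries_deriv mnm0E mul1r.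
  by case: ifP => // /negP[]; apply/forallP => j; rewrite mnm0E eqxx implybT.
apply: germP; apply/funext => m.
rewrite (big_morph (@germ_coef n K) (id1 := 0) (op1 := +%R)) // mseries_sumE.
under eq_bigr do rewrite [germ_coef (_ * _)]/= mseries_XUM.
have [->|m0] := eqVneq m 0%MM.
  by rewrite big1 => [|i _]; [exact: g0|rewrite mnm0E eqxx].
have [i0 mi0] := mnm_neq0 m0.
have [i mi imin] := arg_minnP (P := fun i => m i != 0%N) (fun i : 'I_n => val i) mi0.
have mj (j : 'I_n) : (j < i)%N -> m j = 0%N.
  by move=> ji; apply/eqP; apply: contraTT ji => /imin; rewrite -leqNgt.
rewrite (bigD1 i) //= (negbTE mi) big1 ?addr0 => [|j ji].
  rewrite /cs submK ?lep1mP //; case: ifP => // /negP[].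
  apply/forallP => j; apply/implyP => ji; rewrite mnmBE mj //.
case: eqP => // /eqP mj0; rewrite /cs; case: ifP => // /forallP/(_ i).
have ij : (i < j)%N by rewrite ltn_neqAle eq_sym ji imin.
by rewrite ij mnmBE mnm1E (negbTE ji) subn0 (negbTE mi).
Qed.

(** The determinant is a unit, and the adjugate matrix gives the inverse. *)
Lemma germ_mx_inverse N (A : 'M[germ n K]_N) :
    map_mx (@germ_at0 n K) A \in unitmx ->
  exists B, A *m B = 1%:M /\ B *m A = 1%:M.
Proof.
rewrite unitmxE unitfE det_map_mx /= => /germ_inverse[h Ah].
exists (h *: \adj A); rewrite -scalemxAr -scalemxAl mul_mx_adj mul_adj_mx.
by rewrite !scale_scalar_mx mulrC Ah.
Qed.

End Germs.

Section Substitution.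
Variables (n N : nat) (K : numFieldType) (phi : 'I_N -> germ n K).
Implicit Types (p q : {mpoly K[N]}).

Lemma mpoly_germ_is_zmod : zmod_morphism (mpoly_germ phi).
Proof. exact: (raddfB (mmap (in_alg (germ n K)) phi)). Qed.

Lemma mpoly_germ_is_monoid : monoid_morphism (mpoly_germ phi).
Proof.
split; first exact: (rmorph1 (mmap (in_alg (germ n K)) phi)).
exact: (rmorphM (mmap (in_alg (germ n K)) phi)).
Qed.

HB.instance Definition _ := GRing.isZmodMorphism.Build
  {mpoly K[N]} (germ n K) (mpoly_germ phi) mpoly_germ_is_zmod.
HB.instance Definition _ := GRing.isMonoidMorphism.Build
  {mpoly K[N]} (germ n K) (mpoly_germ phi) mpoly_germ_is_monoid.

Lemma mpoly_germC c : mpoly_germ phi c%:MP = c%:A.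
Proof. exact: (mmapC phi (in_alg (germ n K))). Qed.

Lemma mpoly_germX i : mpoly_germ phi 'X_i = phi i.
Proof. by rewrite /mpoly_germ (mmapX phi (in_alg (germ n K))) mmap1U. Qed.

Lemma mpoly_germZ c q : mpoly_germ phi (c *: q) = c *: mpoly_germ phi q.
Proof. by rewrite -mul_mpolyC rmorphM /= mpoly_germC mulr_algl. Qed.

Lemma mpoly_germ_at0 q :
  germ_at0 (mpoly_germ phi q) = q.@[fun j => germ_at0 (phi j)].
Proof.
elim/mpoly_ring_ind: q => [c|i|p q IHp IHq|p q IHp IHq].
- by rewrite mpoly_germC germ_at0A mevalC.
- by rewrite mpoly_germX mevalXU.
- by rewrite !rmorphD /= IHp IHq.
- by rewrite !rmorphM /= IHp IHq.
Qed.

Lemma mpoly_germ_deriv s q : germ_deriv s (mpoly_germ phi q) =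
  \sum_j mpoly_germ phi q^`M(j) * germ_deriv s (phi j).
Proof.
elim/mpoly_ring_ind: q => [c|i|p q IHp IHq|p q IHp IHq].
- rewrite mpoly_germC germ_derivA big1 // => j _.
  by rewrite mderivC rmorph0 mul0r.
- rewrite mpoly_germX (bigD1 i) //= big1 => [|j ji].
    rewrite mderivX mnm1E eqxx scale1r -{1}[U_(i)%MM]add0m addmK.
    by rewrite mpolyX0 rmorph1 mul1r addr0.
  by rewrite mderivX mnm1E eq_sym (negbTE ji) scale0r rmorph0 mul0r.
- rewrite rmorphD raddfD /= IHp IHq -big_split /=; apply: eq_bigr => j _.
  by rewrite mderivD rmorphD mulrDl.
- rewrite rmorphM germ_derivM IHp IHq mulr_suml mulr_sumr -big_split /=.
  apply: eq_bigr => j _; rewrite mderivM rmorphD !rmorphM /=.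
  by rewrite mulrDl mulrAC mulrA.
Qed.

End Substitution.

(** * Polynomials vanishing to high order at a point *)

Section PolynomialOrder.
Variables (N : nat) (K : fieldType) (a : 'I_N -> K).
Implicit Types (p q : {mpoly K[N]}) (m : 'X_{1..N}).

Definition taylor q : {mpoly K[N]} := q \mPo [tuple 'X_j + (a j)%:MP | j < N].

Definition mpoly_vanish M q : Prop := forall m, (mdeg m < M)%N -> (taylor q)@_m = 0.

HB.instance Definition _ := GRing.RMorphism.copy taylor
  (comp_mpoly [tuple 'X_j + (a j)%:MP | j < N]).

Lemma taylorX i : taylor 'X_i = 'X_i + (a i)%:MP.
Proof. by rewrite /taylor comp_mpolyXU -tnth_nth tnth_mktuple. Qed.

Lemma taylorC c : taylor c%:MP = c%:MP.
Proof. exact: comp_mpolyC. Qed.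

Lemma taylor_deriv j q : taylor q^`M(j) = (taylor q)^`M(j).
Proof.
elim/mpoly_ring_ind: q => [c|i|p q IHp IHq|p q IHp IHq].
- by rewrite taylorC mderivC rmorph0.
- rewrite taylorX mderivD mderivC addr0 mderivX mnm1E.
  have [->|ij] := eqVneq i j; last by rewrite scale0r rmorph0.
  by rewrite -{1 3}[U_(j)%MM]add0m addmK mpolyX0 scale1r rmorph1.
- by rewrite mderivD !rmorphD mderivD /= IHp IHq.
- by rewrite mderivM rmorphD !rmorphM mderivM /= IHp IHq.
Qed.

Lemma taylor_at0 q : (taylor q)@_0%MM = q.@[a].
Proof.
elim/mpoly_ring_ind: q => [c|i|p q IHp IHq|p q IHp IHq].
- by rewrite taylorC mevalC mcoeffC eqxx mulr1.
- by rewrite taylorX mcoeffD mcoeffX mcoeffC eqxx mulr1 mevalXU mnm1_eq0 add0r.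
- by rewrite rmorphD mcoeffD mevalD IHp IHq.
- by rewrite rmorphM rmorphM mevalM -IHp -IHq.
Qed.

Lemma taylorE q : q = \sum_(m : 'X_{1..N < msize (taylor q)})
  (taylor q)@_m *: \prod_j ('X_j - (a j)%:MP) ^+ m j.
Proof.
pose back q := q \mPo [tuple 'X_j - (a j)%:MP | j < N] : {mpoly K[N]}.
have backK r : back (taylor r) = r.
  elim/mpoly_ring_ind: r => [c|i|p r IHp IHr|p r IHp IHr].
  - by rewrite taylorC /back comp_mpolyC.
  - rewrite taylorX /back rmorphD /= comp_mpolyC comp_mpolyXU -tnth_nth tnth_mktuple.
    by rewrite subrK.
  - by rewrite rmorphD /back rmorphD /= -!/(back _) IHp IHr.
  - by rewrite rmorphM /back rmorphM /= -!/(back _) IHp IHr.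
rewrite -{1}[q]backK /back (comp_mpolywE _ (leqnn _)).
apply: eq_bigr => m _; congr (_ *: _); apply: eq_bigr => j _.
by rewrite tnth_mktuple.
Qed.

Lemma mpoly_vanish0 q : mpoly_vanish 0 q.
Proof. by []. Qed.

Lemma mpoly_vanishS M j q :
  mpoly_vanish M q -> mpoly_vanish M.+1 (('X_j - (a j)%:MP) * q).
Proof.
move=> vq m mM; rewrite rmorphM rmorphB /= taylorX taylorC addrK mcoeffXUM.
by case: eqP => // /eqP mj; apply: vq; rewrite -ltnS -(mdeg_subU mj).
Qed.

Lemma mpoly_vanish_deriv M q : [pchar K] =i pred0 ->
  q.@[a] = 0 -> (forall j, mpoly_vanish M q^`M(j)) -> mpoly_vanish M.+1 q.
Proof.
move=> /pcharf0P charK qa vq m mM.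
have [->|] := eqVneq m 0%MM; first by rewrite taylor_at0.
move=> /mnm_neq0[j mj]; have /eqP : (taylor q^`M(j))@_(m - U_(j)) = 0.
  by apply: vq; rewrite -ltnS -(mdeg_subU mj).
rewrite taylor_deriv mcoeff_deriv (mnm_subUK mj) -mulr_natl mulf_eq0 charK.
by case/orP => // /eqP.
Qed.

(** A monomial of high degree contains a high power of some variable. *)
Lemma mpoly_vanish_nilpotent (I : set {mpoly K[N]}) : is_ideal I -> (0 < N)%N ->
    (forall j, exists D, I (('X_j - (a j)%:MP) ^+ D)) ->
  exists M, mpoly_vanish M `<=` I.
Proof.
move=> II N0 /choice[D ID]; exists (\sum_j D j)%N => q vq.
rewrite [q]taylorE; apply: (ideal_sum II) => m _.
have [/vq ->|Dm] := ltnP (mdeg m) (\sum_j D j).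
  by rewrite scale0r; apply: ideal_zero II.
apply: (ideal_mpolyZ II).
have [j Dj] : exists j, (D j <= m j)%N.
  apply: contrapT => nD; move: Dm; rewrite leqNgt => /negP; apply.
  have lt j : (m j < D j)%N by rewrite ltnNge; apply/negP => ?; apply: nD; exists j.
  rewrite mdegE (bigD1 (Ordinal N0)) //= [ltnRHS](bigD1 (Ordinal N0)) //=.
  by rewrite -addSn leq_add // leq_sum // => j _; apply: ltnW.
rewrite (bigD1 j) //= -(subnK Dj) exprD -mulrA; apply: (ideal_mull II).
exact: (ideal_mulr II).
Qed.

End PolynomialOrder.

Lemma euler_formula (R : comNzRingType) N d (q : {mpoly R[N]}) :
  q \is d.-homog -> \sum_j 'X_j * q^`M(j) = d%:R *: q.
Proof.
move=> qd; rewrite {2}[q]mpolyE scaler_sumr.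
have E (m : 'X_{1..N}) :
    \sum_j 'X_j * ('X_[m] : {mpoly R[N]})^`M(j) = (mdeg m)%:R *: 'X_[m].
  rewrite mdegE natr_sum scaler_suml; apply: eq_bigr => j _.
  rewrite mderivX -scalerAr -mpolyXD; have [->|mj] := eqVneq (m j) 0%N.
    by rewrite !scale0r.
  by rewrite addmC mnm_subUK.
under eq_bigr => j _ do rewrite {1}[q]mpolyE raddf_sum mulr_sumr /=.
rewrite exchange_big /= [LHS]big_seq [RHS]big_seq.
apply: eq_bigr => m /(dhomog_mf qd) md.
rewrite scalerA mulrC -scalerA -md -E scaler_sumr.
by apply: eq_bigr => j _; rewrite mderivZ -scalerAr.
Qed.

Lemma dhomog_deriv (R : comNzRingType) N d j (q : {mpoly R[N]}) :
  q \is d.-homog -> q^`M(j) \is d.-1.-homog.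
Proof.
move=> qd; rewrite [q]mpolyE raddf_sum big_seq /=; apply: rpred_sum => m.
move=> /(dhomog_mf qd) md; rewrite mderivZ mderivX; apply/rpredZ.
have [->|mj] := eqVneq (m j) 0%N; first by rewrite scale0r rpred0.
apply/rpredZ; rewrite dhomogX; apply/eqP; rewrite -md.
by rewrite -[RHS]/((mdeg m).-1) (mdeg_subU mj).
Qed.

(** * Local coordinates of projective space *)

Section Coordinates.
Variables (n : nat) (K : numFieldType) (phi : 'I_n.+1 -> germ n K).

Definition jacobian : 'M[germ n K]_n.+1 :=
  row_mx (\col_j phi j) (\matrix_(j, i) germ_deriv i (phi j)).

Let a j := germ_at0 (phi j).

Let jac0 := row_mx (\col_j germ_at0 (phi j))
  (\matrix_(j, i) germ_at0 (germ_deriv i (phi j))).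
Hypothesis jac_unit : jac0 \in (unitmx : {pred 'M[K]_n.+1}).

Lemma jacobian_inverse : exists B, jacobian *m B = 1%:M /\ B *m jacobian = 1%:M.
Proof.
apply: germ_mx_inverse; suff -> : map_mx (@germ_at0 n K) jacobian = jac0 by [].
apply: etrans (map_row_mx (@germ_at0 n K) (\col_j phi j) _) _.
by congr (row_mx _ _); apply/matrixP => i j; rewrite !mxE.
Qed.

(** With [phi = a + sum_s y_s c_s] the matrix with columns [a] and the [c_s] is
    invertible, because its value at 0 is the one of the jacobian; it expresses
    the coordinates [y_s] in terms of the [phi_j - a_j]. *)
Lemma germ_maximal_ideal g : germ_at0 g = 0 ->
  exists c : 'I_n.+1 -> germ n K, g = \sum_j (phi j - (a j)%:A) * c j.
Proof.
have /choice[c cP] j := germ_hadamard (germ_at0_sub (phi j)).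
pose C : 'M[germ n K]_n.+1 := row_mx (\col_j (a j)%:A) (\matrix_(j, i) c j i).
have [C' [_ CC]] : exists C', C *m C' = 1%:M /\ C' *m C = 1%:M.
  apply: germ_mx_inverse; suff -> : map_mx (@germ_at0 n K) C = jac0 by [].
  apply: etrans (map_row_mx (@germ_at0 n K) (\col_j (a j)%:A) _) _.
  congr (row_mx _ _); apply/matrixP => i j; rewrite !mxE.
    exact: germ_at0A.
  by rewrite (cP _).2 raddfB /= germ_derivA subr0.
pose y : 'cV[germ n K]_(1 + n) := col_mx 0 (\col_i germ_var K i).
have Cy : C *m y = \col_j (phi j - (a j)%:A).
  apply: etrans (mul_row_col (\col_j (a j)%:A) _ _ _) _.
  rewrite mulmx0 add0r; apply/matrixP => j k; rewrite !mxE.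
  by rewrite (cP j).1; apply: eq_bigr => i _; rewrite !mxE mulrC.
have yE : y = C' *m \col_j (phi j - (a j)%:A) by rewrite -Cy mulmxA CC mul1mx.
have yi i : germ_var K i = \sum_j C' (rshift 1 i) j * (phi j - (a j)%:A).
  have := congr1 (fun Y : 'cV_(1 + n) => Y (rshift 1 i) 0) yE.
  rewrite /y col_mxEd !mxE => ->; apply: eq_bigr => j _; by rewrite mxE.
move=> /germ_hadamard[b [-> _]].
exists (fun j => \sum_i C' (rshift 1 i) j * b i).
under eq_bigr do rewrite yi mulr_suml.
rewrite exchange_big /=; apply: eq_bigr => j _; rewrite mulr_sumr.
by apply: eq_bigr => i _; rewrite mulrCA mulrA.
Qed.

Local Notation Phi := (mpoly_germ phi).

Lemma mpoly_germ_vanish M q : mpoly_vanish a M q -> vanish M (Phi q).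
Proof.
move=> vq; rewrite [q](taylorE a) raddf_sum.
apply: (ideal_sum (germ_vanish_ideal n K M)) => m _ /=.
rewrite mpoly_germZ; have [/vq ->|Mm] := ltnP (mdeg m) M.
  by rewrite scale0r; apply: ideal_zero (germ_vanish_ideal n K M).
rewrite -mulr_algl; apply: (ideal_mull (germ_vanish_ideal n K M)).
suff : vanish (mdeg m) (Phi (\prod_j ('X_j - (a j)%:MP) ^+ m j)).
  by move=> v k kM; apply: v; apply: leq_trans kM Mm.
rewrite rmorph_prod mdegE /=.
apply: (big_ind2 (fun (g : germ n K) N => vanish N g)) => [k|g N h L|j _].
- by rewrite ltn0.
- exact: vanishM.
rewrite rmorphXn rmorphB /= mpoly_germX mpoly_germC.
have -> : germ_coef ((phi j - (a j)%:A) ^+ m j) = germ_coef (phi j - (a j)%:A) ^+ m j.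
  by elim: (m j) => [|k IH]; rewrite ?expr0 // !exprS /= -IH.
exact/vanishX/germ_vanish1/germ_at0_sub.
Qed.

(** Induction on the order: by the chain rule and Euler's formula the jacobian
    maps the germs of the partial derivatives of [q] to that of [q] and its
    partial derivatives. *)
Lemma mpoly_germ_vanish_homog M d q : q \is d.-homog ->
  vanish M (Phi q) -> mpoly_vanish a M q.
Proof.
elim: M d q => [|M IH] d q qd vq; first exact: mpoly_vanish0.
have VI := germ_vanish_ideal n K M.
apply: mpoly_vanish_deriv => [| |j]; first exact: pchar_num.
  rewrite -(mpoly_germ_at0 phi); apply/germ_vanish1 => m m1; apply: vq.
  exact: leq_trans m1 _.
apply: IH (dhomog_deriv j qd) _.
have [B [JB _]] := jacobian_inverse.
pose v : 'rV[germ n K]_n.+1 := \row_j Phi q^`M(j).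
have vJ i : vanish M ((v *m jacobian) 0 i).
  rewrite [v *m jacobian](mul_mx_row v (\col_j phi j)).
  rewrite mxE; case: splitP => k _.
    rewrite mxE.
    rewrite (eq_bigr (fun j => Phi ('X_j * q^`M(j)))); last first.
      by move=> l _; rewrite !mxE rmorphM /= mpoly_germX mulrC.
    rewrite -raddf_sum (euler_formula qd) /= mpoly_germZ -mulr_algl.
    by apply: (ideal_mull VI) => m mM; apply: vq; apply: ltnW.
  rewrite mxE.
  rewrite (eq_bigr (fun j => Phi q^`M(j) * germ_deriv k (phi j))); last first.
    by move=> l _; rewrite !mxE.
  by rewrite -mpoly_germ_deriv; apply: vanish_deriv.
have -> : Phi q^`M(j) = ((v *m jacobian) *m B) 0 j by rewrite -mulmxA JB mulmx1 mxE.
by rewrite mxE; apply: (ideal_sum VI) => i _; apply: (ideal_mulr VI); exact: vJ.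
Qed.

(** Given a remainder that is a combination of germs of polynomials of order [M],
    the constant terms of the coefficients are absorbed into the approximating
    polynomial; the new coefficients lie in the maximal ideal, whose generators
    raise the order to [M.+1]. *)
Lemma germ_jet M g :
  exists q, ideal_gen [set Phi r | r in mpoly_vanish a M] (g - Phi q).
Proof.
elim: M => [|M [q]].
  exists 0; rewrite rmorph0 subr0 -(mulr1 g); apply: (ideal_mull (ideal_genP _)).
  by apply: ideal_gen_in; exists 1; rewrite ?rmorph1.
move=> [s [sP gE]].
have [r rP] : exists r, ideal_gen [set Phi r | r in mpoly_vanish a M.+1]
    (\sum_(u <- s) u.1 * u.2 - Phi r).
  elim: s sP {gE} => [_|u s IH sP].
    exists 0; rewrite big_nil rmorph0 subr0; exact: ideal_zero (ideal_genP _).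
  have [w ws|r rP] := IH; first by apply: sP; rewrite inE ws orbT.
  have [t vt tu] : [set Phi r | r in mpoly_vanish a M] u.2.
    by apply: sP; rewrite inE eqxx.
  have [c cE] := germ_maximal_ideal (germ_at0_sub u.1).
  exists (germ_at0 u.1 *: t + r); rewrite big_cons.
  have -> : u.1 * u.2 + \sum_(j <- s) j.1 * j.2 - Phi (germ_at0 u.1 *: t + r) =
     (u.1 - (germ_at0 u.1)%:A) * u.2 + (\sum_(j <- s) j.1 * j.2 - Phi r).
    rewrite rmorphD /= mpoly_germZ -tu -[_ *: _]mulr_algl.
    by move: (\sum_(j <- s) _) (_%:A) (Phi t) (Phi r) => w x y z; ring.
  apply: (ideal_add (ideal_genP _)) => //.
  rewrite cE mulr_suml; apply: (ideal_sum (ideal_genP _)) => j _.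
  rewrite -tu mulrAC; apply: (ideal_mulr (ideal_genP _)); apply: ideal_gen_in.
  exists (('X_j - (a j)%:MP) * t); first exact: mpoly_vanishS.
  by rewrite rmorphM rmorphB /= mpoly_germX mpoly_germC.
by exists (q + r); rewrite rmorphD opprD addrA gE.
Qed.

End Coordinates.

(** * Ideals of minors *)

Section Minors.
Variable A : comNzRingType.
Implicit Types (I : set A) (k N : nat).

(** [s] comes from sorting the tuple of the values of [r]. *)
Lemma sort_injective k N (r : 'I_k -> 'I_N) : injective r ->
  exists s : 'S_k, {homo (r \o s) : i j / (i < j)%N}.
Proof.
move=> rI; pose le (i j : 'I_N) := (i <= j)%N.
pose t := [tuple r i | i < k].
have /tuple_permP[s ts] : perm_eq (sort le t) t by rewrite perm_sort.
have st : size (sort le t) = k by rewrite size_sort size_tuple.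
have rs i x0 : r (s i) = nth x0 (sort le t) i.
  by rewrite ts (nth_map i) ?size_enum_ord // nth_ord_enum !tnth_mktuple.
exists s => i j ij /=; rewrite ltn_neqAle; apply/andP; split.
  apply/eqP => /val_inj/rI/perm_inj eij; by rewrite eij ltnn in ij.
rewrite (rs i (r i)) (rs j (r i)).
have tot : total le by move=> x y; apply: leq_total.
have tr : transitive le by move=> x y z; apply: leq_trans.
have rf : reflexive le by move=> x; apply: leqnn.
have := sort_sorted tot t => srt.
by apply: (sorted_leq_nth tr rf (r i) srt) => //; rewrite ?inE ?st // ltnW.
Qed.

(** Repetitions make the determinant vanish, and sorting the rows and the columns
    changes it at most by a sign. *)
Lemma minors_any k N (M : 'M[A]_N) (r c : 'I_k -> 'I_N) :
  ideal_gen (minors k M) (\det (mxsub r c M)).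
Proof.
have [rI|/negP rI] := boolP (injectiveb r); last first.
  have /injectivePn[i [j ij rij]] : ~~ injectiveb r by apply/negP.
  rewrite (determinant_alternate ij); first exact: ideal_zero (ideal_genP _).
  by move=> l; rewrite !mxE rij.
have [cI|/negP cI] := boolP (injectiveb c); last first.
  have /injectivePn[i [j ij cij]] : ~~ injectiveb c by apply/negP.
  rewrite -det_tr (determinant_alternate ij); first exact: ideal_zero (ideal_genP _).
  by move=> l; rewrite !mxE cij.
have [s rs] := sort_injective (injectiveP _ rI).
have [t ct] := sort_injective (injectiveP _ cI).
have -> : mxsub r c M = row_perm s^-1%g (col_perm t^-1%g (mxsub (r \o s) (c \o t) M)).
  by apply/matrixP => i j; rewrite !mxE /= !permKV.
rewrite row_permE col_permE !det_mulmx det_perm mulrA mulrC.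
rewrite mulrA; apply: (ideal_mull (ideal_genP _)); apply: ideal_gen_in.
by exists (r \o s), (c \o t).
Qed.

Lemma minors_in I k N (M : 'M[A]_N) :
  (forall r c : 'I_k -> 'I_N, I (\det (mxsub r c M))) -> minors k M `<=` I.
Proof. by move=> IM _ [r [c [_ _ ->]]]. Qed.

Lemma minors_tr k N (M : 'M[A]_N) : minors k M^T = minors k M.
Proof.
apply/seteqP; split=> _ [r [c [rh ch ->]]]; exists c, r; split=> //;
  rewrite -det_tr; congr (\det _); by apply/matrixP => i j; rewrite !mxE.
Qed.

(** The easy half of the Cauchy-Binet formula: the rows of [P *m Q] are
    combinations of rows of [Q], so by multilinearity the determinant is a
    combination of determinants formed with rows of [Q]. *)
Lemma det_mulmx_rect k N (P : 'M[A]_(k, N)) (Q : 'M[A]_(N, k)) :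
  \det (P *m Q) =
  \sum_(s : {ffun 'I_k -> 'I_N}) (\prod_i P i (s i)) * \det (rowsub s Q).
Proof.
under [RHS]eq_bigr do rewrite /determinant mulr_sumr.
rewrite exchange_big /=; apply: eq_bigr => s _.
under eq_bigr do rewrite mxE.
rewrite bigA_distr_bigA mulr_sumr; apply: eq_bigr => t _ /=.
rewrite big_split /= mulrCA; congr (_ * (_ * _)).
by apply: eq_bigr => i _; rewrite !mxE.
Qed.

Lemma minors_mulmx_l k N (P Q : 'M[A]_N) :
  minors k (P *m Q) `<=` ideal_gen (minors k Q).
Proof.
apply: minors_in => r c.
have -> : mxsub r c (P *m Q) = rowsub r P *m colsub c Q.
  by apply/matrixP => i j; rewrite !mxE; apply: eq_bigr => l _; rewrite !mxE.
rewrite det_mulmx_rect; apply: (ideal_sum (ideal_genP _)) => s _.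
apply: (ideal_mull (ideal_genP _)).
have -> : rowsub s (colsub c Q) = mxsub s c Q by apply/matrixP => i j; rewrite !mxE.
exact: minors_any.
Qed.

Lemma minors_mulmx_r k N (P Q : 'M[A]_N) :
  minors k (P *m Q) `<=` ideal_gen (minors k P).
Proof. by rewrite -minors_tr trmx_mul -(minors_tr k P); apply: minors_mulmx_l. Qed.

(** The determinant is a polynomial in the entries. *)
Lemma det_congr I k (P Q : 'M[A]_k) : is_ideal I ->
  (forall i j, I (P i j - Q i j)) -> I (\det P - \det Q).
Proof.
move=> II PQ; rewrite /determinant -sumrB; apply: (ideal_sum II) => s _.
rewrite -mulrBr; apply: (ideal_mull II).
apply: (big_ind2 (fun x y => I (x - y))) => [|x y z w Ixy Izw|i _]; last exact: PQ.
  by rewrite subrr; apply: ideal_zero II.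
have -> : x * z - y * w = z * (x - y) + y * (z - w) by ring.
by apply: (ideal_add II); apply: (ideal_mull II).
Qed.

Lemma minors_congr I k N (P Q : 'M[A]_N) : is_ideal I ->
  (forall i j, I (P i j - Q i j)) -> minors k Q `<=` I -> minors k P `<=` I.
Proof.
move=> II PQ QI _ [r [c [rh ch ->]]].
apply: (@ideal_subK _ _ II _ (\det (mxsub r c Q))); last by apply: QI; exists r, c.
by apply: det_congr => // i j; rewrite !mxE.
Qed.

Lemma minors_scale k N a (P : 'M[A]_N) :
  minors k (a *: P) `<=` ideal_gen (minors k P).
Proof. by rewrite -mul_scalar_mx; apply: minors_mulmx_l. Qed.

(** The shape of the Hessian matrix of a form in local coordinates: by Euler's
    formula the radial direction contributes a zero row and a zero column. *)
Definition bordered N (Q : 'M[A]_N) : 'M[A]_N.+1 := block_mx (0 : 'M_1) 0 0 Q.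

Lemma borderedE N (Q : 'M[A]_N) i j : bordered Q i j =
  if unlift ord0 i is Some i' then
    if unlift ord0 j is Some j' then Q i' j' else 0
  else 0.
Proof.
rewrite /bordered !mxE; case: splitP => k ik; rewrite !mxE.
  have -> : i = ord0 by apply: val_inj; rewrite /= ik ord1.
  by rewrite unlift_none; case: splitP => l _; rewrite ?mxE.
have -> : i = lift ord0 k by apply: val_inj; rewrite /= ik.
rewrite liftK; case: splitP => l jl; rewrite ?mxE.
  have -> : j = ord0 by apply: val_inj; rewrite /= jl ord1.
  by rewrite unlift_none.
have -> : j = lift ord0 l by apply: val_inj; rewrite /= jl.
by rewrite liftK.
Qed.

(** A minor that involves the zero row or the zero column is zero. *)
Lemma minors_bordered k N (Q : 'M[A]_N) :
  minors k (bordered Q) `<=` ideal_gen (minors k Q).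
Proof.
apply: minors_in => r c.
have [/existsP[i /eqP ri]|/existsPn nr] := boolP [exists i, r i == ord0].
  rewrite (expand_det_row _ i) big1 => [|j _]; first exact: ideal_zero (ideal_genP _).
  by rewrite mxE borderedE ri unlift_none mul0r.
have [/existsP[i /eqP ci]|/existsPn nc] := boolP [exists i, c i == ord0].
  rewrite (expand_det_col _ i) big1 => [|j _]; first exact: ideal_zero (ideal_genP _).
  by rewrite mxE borderedE ci unlift_none; case: unlift => [?|]; rewrite mul0r.
have /choice[r' r'P] i : exists i', r i = lift ord0 i'.
  by have := nr i; rewrite eq_sym => /unlift_some[j -> _]; exists j.
have /choice[c' c'P] i : exists i', c i = lift ord0 i'.
  by have := nc i; rewrite eq_sym => /unlift_some[j -> _]; exists j.
have -> : mxsub r c (bordered Q) = mxsub r' c' Q.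
  by apply/matrixP => i j; rewrite [LHS]mxE [RHS]mxE borderedE r'P c'P !liftK.
exact: minors_any.
Qed.

Lemma minors_of_bordered k N (Q : 'M[A]_N) :
  minors k Q `<=` ideal_gen (minors k (bordered Q)).
Proof.
apply: minors_in => r c.
have -> : mxsub r c Q = mxsub (lift ord0 \o r) (lift ord0 \o c) (bordered Q).
  by apply/matrixP => i j; rewrite [LHS]mxE [RHS]mxE borderedE /= !liftK.
exact: minors_any.
Qed.

End Minors.

(** * The Hessian ideal in local coordinates *)

Section LocalHessian.
Variables (n : nat) (K : numFieldType).
Implicit Types (g h : germ n K) (k : nat).

Local Notation D := (@germ_deriv n K).

(** Modulo [(g) + J_g], the first derivatives of [u * g] vanish and the second
    ones are [u] times those of [g]. *)
Lemma local_hess_ideal_mul u g k :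
  local_hess_ideal (u * g) k `<=` local_hess_ideal g k.
Proof.
set I := local_hess_ideal g k; have II : is_ideal I := ideal_genP _.
have Ig : I g by apply: ideal_gen_in; left; left.
have ID i : I (D i g) by apply: ideal_gen_in; left; right; exists i.
apply: (ideal_gen_min II) => x [[->|[i ->]]|].
- exact: (ideal_mull II).
- rewrite germ_derivM; apply: (ideal_add II); first exact: (ideal_mull II).
  exact: (ideal_mull II).
apply: (minors_congr (Q := u *: hess D g) II) x => [i j|x].
  rewrite !mxE !germ_derivM raddfD /= !germ_derivM.
  have -> : D i (D j u) * g + D j u * D i g + (D i u * D j g + u * D i (D j g))
      - u * D i (D j g) = D i (D j u) * g + D j u * D i g + D i u * D j g.
    move: (D i (D j u)) (D i (D j g)) (D j u) (D i u) (D i g) (D j g).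
    by move=> a b c d e e'; ring.
  by do 2?[apply: (ideal_add II)]; apply: (ideal_mull II).
move=> /minors_scale; apply: ideal_gen_mono => y hy.
by apply: ideal_gen_in; right.
Qed.

Lemma local_hess_ideal_unit u g k : germ_at0 u != 0 ->
  local_hess_ideal (u * g) k = local_hess_ideal g k.
Proof.
move=> /germ_inverse[v uv]; apply/seteqP; split; first exact: local_hess_ideal_mul.
by rewrite -{1}(mul1r g) -uv [u * v]mulrC -mulrA; apply: local_hess_ideal_mul.
Qed.

Variables (phi : 'I_n.+1 -> germ n K) (f : {mpoly K[n.+1]}) (d : nat).
Hypothesis jac_unit : row_mx (\col_j germ_at0 (phi j))
  (\matrix_(j, i) germ_at0 (germ_deriv i (phi j))) \in (unitmx : {pred 'M[K]_n.+1}).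
Hypothesis fd : f \is d.-homog.
Hypothesis d0 : (0 < d)%N.

Local Notation Phi := (mpoly_germ phi).
Local Notation Df := (@mderiv n.+1 K).
Local Notation F := (Phi f).
Local Notation JF := (ideal_gen [set Phi r | r in partials Df f]).
Local Notation J := (jacobian phi).

Let row_mx1E (T : Type) m (a : 'M[T]_(m, 1)) (b : 'M[T]_(m, n)) i (j : 'I_n.+1) :
  row_mx a b i j = if unlift ord0 j is Some j' then b i j' else a i ord0.
Proof.
rewrite mxE; case: splitP => l jl.
  have -> : j = ord0 by apply: val_inj; rewrite /= jl ord1.
  by rewrite unlift_none ord1.
have -> : j = lift ord0 l by apply: val_inj; rewrite /= jl.
by rewrite liftK.
Qed.

Let JE i j : J i j = if unlift ord0 j is Some j' then D j' (phi i) else phi i.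
Proof. by rewrite /jacobian row_mx1E; case: unlift => [l|]; rewrite mxE. Qed.

Let euler_germ e (q : {mpoly K[n.+1]}) : q \is e.-homog ->
  \sum_j Phi q^`M(j) * phi j = e%:R *: Phi q.
Proof.
move=> qe; rewrite -mpoly_germZ -(euler_formula qe) raddf_sum /=.
by apply: eq_bigr => j _; rewrite rmorphM /= mpoly_germX mulrC.
Qed.

(** The chain rule together with Euler's formula. *)
Let gradient_jacobian e (q : {mpoly K[n.+1]}) i : q \is e.-homog ->
  ((\row_j Phi q^`M(j)) *m J) 0 i =
  if unlift ord0 i is Some s then D s (Phi q) else e%:R *: Phi q.
Proof.
move=> qe; rewrite mxE; under eq_bigr do rewrite JE mxE.
case: unlift => [s|]; first by rewrite mpoly_germ_deriv.
exact: euler_germ.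
Qed.

Let IJF : is_ideal JF := ideal_genP _.

Let JF_partial j : JF (Phi f^`M(j)).
Proof. by apply: ideal_gen_in; exists f^`M(j) => //; exists j. Qed.

Let JF_F : JF F.
Proof.
have -> : F = (d%:R^-1)%:A * (d%:R *: F).
  by rewrite mulr_algl scalerA mulVf ?scale1r // pnatr_eq0 -lt0n.
rewrite -(euler_germ fd); apply: (ideal_mull IJF); apply: (ideal_sum IJF) => j _.
exact: (ideal_mulr IJF).
Qed.

Let JF_deriv s : JF (D s F).
Proof.
rewrite mpoly_germ_deriv; apply: (ideal_sum IJF) => j _.
exact: (ideal_mulr IJF).
Qed.

(** The jacobian is invertible, so the partial derivatives of [f] are combinations
    of the local equation and its derivatives. *)
Let JF_sub (I : set (germ n K)) :
  is_ideal I -> I F -> (forall s, I (D s F)) -> JF `<=` I.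
Proof.
move=> II IF IDF; have [B [JB _]] := jacobian_inverse jac_unit.
apply: (ideal_gen_min II) => _ [_ [j ->] <-].
have -> : Phi f^`M(j) = ((\row_j Phi f^`M(j)) *m J *m B) 0 j.
  by rewrite -mulmxA JB mulmx1 mxE.
rewrite mxE; apply: (ideal_sum II) => i _; apply: (ideal_mulr II).
rewrite (gradient_jacobian _ fd); case: unlift => // .
by rewrite -mulr_algl; apply: (ideal_mull II).
Qed.

Local Notation H := (map_mx Phi (hess Df f)).

(** Differentiate the chain rule and Euler's formula once more: every correction
    term contains a first partial derivative of [f]. *)
Let hess_jacobian i j : JF ((J^T *m H *m J) i j - bordered (hess D F) i j).
Proof.
have HJ l : (H *m J) l j = if unlift ord0 j is Some s
    then D s (Phi f^`M(l)) else d.-1%:R *: Phi f^`M(l).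
  rewrite -(gradient_jacobian j (dhomog_deriv l fd)) !mxE.
  by apply: eq_bigr => k _; rewrite !mxE mderiv_comm.
rewrite -mulmxA mxE borderedE.
under eq_bigr do rewrite mxE JE HJ.
case: unlift => [s|]; case: unlift => [t|]; rewrite ?subr0.
- rewrite !mxE germ_deriv_comm (mpoly_germ_deriv _ s) raddf_sum /= -sumrB.
  apply: (ideal_sum IJF) => l _; rewrite germ_derivM mulrC opprD addrA subrr sub0r.
  by apply: (ideal_opp IJF); apply: (ideal_mulr IJF).
- apply: (ideal_sum IJF) => l _; rewrite -mulr_algl.
  by do 2 apply: (ideal_mull IJF).
- have -> : \sum_l phi l * D t (Phi f^`M(l)) =
      d%:R *: D t F - \sum_l Phi f^`M(l) * D t (phi l).
    rewrite -linearZ /= -(euler_germ fd) raddf_sum -sumrB /=.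
    by apply: eq_bigr => l _; rewrite germ_derivM addrK mulrC.
  apply: (ideal_sub IJF); first by rewrite -mulr_algl; apply: (ideal_mull IJF).
  by apply: (ideal_sum IJF) => l _; apply: (ideal_mulr IJF).
- apply: (ideal_sum IJF) => l _; rewrite -mulr_algl.
  by do 2 apply: (ideal_mull IJF).
Qed.

(** Multiplication by matrices does not enlarge ideals of minors, so the congruence
    of Hessian matrices gives one inclusion with the jacobian and the other one
    with its inverse. *)
Lemma hess_ideal_local k :
  ideal_gen [set Phi r | r in partials Df f `|` minors k (hess Df f)] =
  local_hess_ideal F k.
Proof.
set E := ideal_gen _; set L := local_hess_ideal F k.
have IE : is_ideal E := ideal_genP _; have IL : is_ideal L := ideal_genP _.
have JE' : JF `<=` E.
  by apply: ideal_gen_mono => _ [r rf <-]; apply: ideal_gen_in; exists r => //; left.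
have JL : JF `<=` L.
  apply: (JF_sub IL) => [|s]; apply: ideal_gen_in; first by left; left.
  by left; right; exists s.
have HE : minors k H `<=` E.
  move=> _ [r [c [rh ch ->]]]; apply: ideal_gen_in.
  exists (\det (mxsub r c (hess Df f))); first by right; exists r, c.
  by rewrite -map_mxsub det_map_mx.
have [B [JB BJ]] := jacobian_inverse jac_unit.
apply/seteqP; split.
  apply: (ideal_gen_min IL) => _ [r [rf|[rr [c [rh ch ->]]]] <-].
    by apply: JL; apply: ideal_gen_in; exists r.
  have HL : minors k H `<=` L.
    have -> : H = B^T *m (J^T *m H *m J) *m B.
      by rewrite !mulmxA -trmx_mul JB trmx1 mul1mx -mulmxA JB mulmx1.
    move=> x /minors_mulmx_r; apply: (ideal_gen_min IL) => {}x /minors_mulmx_l.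
    apply: (ideal_gen_min IL) => {}x.
    apply: (minors_congr IL) => [i j|{}x /minors_bordered].
      exact/JL/hess_jacobian.
    by apply: ideal_gen_mono => y hy; apply: ideal_gen_in; right.
  by apply: HL; exists rr, c; rewrite -map_mxsub det_map_mx.
apply: (ideal_gen_min IE) => x [[->|[i ->]]|].
- exact/JE'/JF_F.
- exact/JE'/JF_deriv.
move=> /minors_of_bordered; apply: (ideal_gen_min IE) => {}x.
apply: (minors_congr (Q := J^T *m H *m J) IE) => [i j|{}x].
  by rewrite -opprB; apply: (ideal_opp IE); apply/JE'/hess_jacobian.
move=> /minors_mulmx_r; apply: (ideal_gen_min IE) => {}x /minors_mulmx_l.
exact: ideal_gen_min HE x.
Qed.

End LocalHessian.

(** * Comparison of the local quotients *)

Section LocalAlgebra.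
Variables (n : nat) (K : numClosedFieldType) (phi : 'I_n.+1 -> germ n K).
Variables (G : set {mpoly K[n.+1]}) (l : {mpoly K[n.+1]}).
Hypothesis jac_unit : row_mx (\col_j germ_at0 (phi j))
  (\matrix_(j, i) germ_at0 (germ_deriv i (phi j))) \in (unitmx : {pred 'M[K]_n.+1}).
Hypothesis l1 : l \is 1.-homog.
Hypothesis phil : mpoly_germ phi l = 1.

Local Notation Phi := (mpoly_germ phi).
Local Notation a := (fun j => germ_at0 (phi j)).
Local Notation B := (ideal_gen (G `|` [set l - 1])).
Local Notation IG := (ideal_gen [set Phi r | r in G]).

Hypothesis Balg : coords_algebraic B.

Let IB : is_ideal B := ideal_genP _.
Let IIG : is_ideal IG := ideal_genP _.
Let IL : is_ideal (local_ideal B a) := local_idealP IB a.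

(** The multiplier of [q] into [B] becomes a unit among the germs. *)
Lemma mpoly_germ_local q : local_ideal B a q -> IG (Phi q).
Proof.
move=> [E Ea BEq]; have [v Ev] : exists v, Phi E * v = 1.
  by apply: germ_inverse; rewrite mpoly_germ_at0.
rewrite -(mul1r (Phi q)) -Ev mulrAC -rmorphM.
apply: (ideal_mulr IIG); apply: (ideal_gen_morph (f := Phi)) BEq => y [Gy|->] /=.
  by apply: ideal_gen_in; exists y.
by rewrite rmorphB rmorph1 /= phil subrr; apply: ideal_zero IIG.
Qed.

Let high_order : exists M, mpoly_vanish a M `<=` local_ideal B a.
Proof.
by apply: (mpoly_vanish_nilpotent IL) => // j; exact: local_ideal_nilpotent.
Qed.

Let high_order_sub M : mpoly_vanish a M `<=` local_ideal B a ->
  ideal_gen [set Phi r | r in mpoly_vanish a M] `<=` IG.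
Proof.
move=> ML; apply: ideal_gen_mono => _ [r /ML vr <-].
exact: mpoly_germ_local.
Qed.

Lemma mpoly_germ_surjective g : exists q, IG (g - Phi q).
Proof.
have [M ML] := high_order; have [q gq] := germ_jet jac_unit M g.
by exists q; apply: high_order_sub ML _ gq.
Qed.

(** Truncating the coefficients of a combination of elements of [Phi G] to
    polynomials leaves an element of high order, which comes from a form modulo
    [l = 1]; for forms, high order of the germ is high order at the point. *)
Lemma mpoly_germ_injective q : IG (Phi q) -> local_ideal B a q.
Proof.
have [M ML] := high_order.
set O := ideal_gen [set Phi r | r in mpoly_vanish a M].
have IO : is_ideal O := ideal_genP _.
have approx : IG `<=` [set x | exists2 y, ideal_gen G y & O (x - Phi y)].
  have IGG := ideal_genP G.
  apply: ideal_gen_min => [|_ [r Gr <-]]; last first.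
    exists r; first exact: ideal_gen_in.
    by rewrite subrr; apply: ideal_zero IO.
  split=> [|x y [r Gr xr] [s Gs ys]|c x [r Gr xr]].
  - exists 0; first exact: ideal_zero IGG.
    by rewrite rmorph0 subrr; apply: ideal_zero IO.
  - exists (r + s); first exact: (ideal_add IGG).
    by rewrite rmorphD opprD addrACA; apply: (ideal_add IO).
  - have [t ct] := germ_jet jac_unit M c.
    exists (t * r); first exact: (ideal_mull IGG).
    have -> : c * x - Phi (t * r) = c * (x - Phi r) + (c - Phi t) * Phi r.
      by rewrite rmorphM /=; move: (Phi t) (Phi r) => u v; ring.
    by apply: (ideal_add IO); [apply: (ideal_mull IO)|apply: (ideal_mulr IO)].
move=> /approx[y Gy Oqy]; set r := q - y.
have Or : O (Phi r) by rewrite rmorphB.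
have vr : vanish M (Phi r).
  apply: (ideal_gen_min (germ_vanish_ideal n K M)) Or => _ [s vs <-].
  exact: mpoly_germ_vanish.
pose h := homogenize l (msize r) r.
have hr (C : set {mpoly K[n.+1]}) : is_ideal C -> C (l - 1) -> C (h - r).
  by move=> IC Cl; apply: homogenize_mod.
have Phih : Phi h = Phi r.
  apply/eqP; rewrite -subr_eq0 -rmorphB; apply/eqP.
  apply: (hr [set s | Phi s = 0]).
    split=> [|s t /= s0 t0|s t /= t0] /=; first by rewrite rmorph0.
      by rewrite rmorphD /= s0 t0 addr0.
    by rewrite rmorphM /= t0 mulr0.
  by rewrite /= rmorphB rmorph1 /= phil subrr.
have Lh : local_ideal B a h.
  apply: ML; apply: (mpoly_germ_vanish_homog jac_unit (d := msize r)).
    exact: homogenizeP.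
  by rewrite Phih.
have Lr : local_ideal B a r.
  have -> : r = h - (h - r) by rewrite opprB addrC subrK.
  apply: (ideal_sub IL) => //; apply: local_ideal_sub; apply: (hr _ IB).
  by apply: ideal_gen_in; right.
apply: (ideal_subK IL Lr); apply: local_ideal_sub.
exact: dehomog_sub.
Qed.

Lemma local_quot_dim_germ d :
  quot_dim setT (local_ideal B a) d -> quot_dim setT IG d.
Proof.
move=> [e [_ span indep]]; exists (Phi \o e).
have PhiS (c : 'I_d -> K) : \sum_i c i *: (Phi \o e) i = Phi (\sum_i c i *: e i).
  by rewrite raddf_sum /=; apply: eq_bigr => i _; rewrite mpoly_germZ.
split=> // [g _|c]; last first.
  by rewrite PhiS => /mpoly_germ_injective; apply: indep.
have [q gq] := mpoly_germ_surjective g; have [c cq] := span q Logic.I.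
exists c; rewrite PhiS -(subrK (Phi q) g) -addrA.
apply: (ideal_add IIG) => //; rewrite -rmorphB.
exact: mpoly_germ_local.
Qed.

End LocalAlgebra.

(** * Systems of local coordinates *)

Section LocalCoordinates.
Variables (n : nat) (K : numClosedFieldType).
Implicit Types (phi : 'I_n.+1 -> germ n K) (a : 'I_n.+1 -> K).

Lemma mpoly_germ_homog phi w d (q : {mpoly K[n.+1]}) : q \is d.-homog ->
  mpoly_germ (fun j => w * phi j) q = w ^+ d * mpoly_germ phi q.
Proof.
move=> qd; rewrite [q]mpolyE !raddf_sum mulr_sumr /= !big_seq.
apply: eq_bigr => m /(dhomog_mf qd) <-.
rewrite !mpoly_germZ -scalerAr; congr (_ *: _).
rewrite mpolyXE_id !rmorph_prod /=.
under eq_bigr do rewrite rmorphXn /= mpoly_germX exprMn.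
rewrite big_split /= prodrXr mdegE; congr (_ * _).
by apply: eq_bigr => i _; rewrite rmorphXn /= mpoly_germX.
Qed.

(** Scaling by [w] multiplies the matrix that defines local coordinates by a block
    triangular matrix with diagonal entries [w(0)]. *)
Lemma local_coordinates_scale a phi w : germ_at0 w != 0 ->
  local_coordinates a phi -> local_coordinates a (fun j => w * phi j).
Proof.
move=> w0 [[c c0 phia] unit]; split.
  exists (germ_at0 w * c); first by rewrite mulf_neq0.
  by move=> j; rewrite rmorphM /= phia mulrA.
pose T : 'M[K]_(1 + n) := block_mx (germ_at0 w)%:M (\row_i germ_at0 (germ_deriv i w))
                        0 (germ_at0 w)%:M.
have Tunit : T \in unitmx.
  by rewrite unitmxE det_ublock !det_scalar unitfE mulf_neq0 ?expf_neq0.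
suff -> : row_mx (\col_j germ_at0 (w * phi j))
    (\matrix_(j, i) germ_at0 (germ_deriv i (w * phi j))) =
  row_mx (\col_j germ_at0 (phi j))
    (\matrix_(j, i) germ_at0 (germ_deriv i (phi j))) *m T.
  exact: etrans (@unitmx_mul _ n.+1 _ T) (introT andP (conj unit Tunit)).
rewrite mul_row_block mulmx0 addr0 !mul_mx_scalar.
congr (row_mx _ _); apply/matrixP => i j; rewrite !mxE ?rmorphM //.
rewrite big_ord1 !mxE germ_derivM rmorphD !rmorphM /=.
by congr (_ + _); apply: mulrC.
Qed.

(** Complete the point to a basis and take the corresponding affine
    coordinates. *)
Lemma local_coordinates_exist a : proj_point a -> exists phi, local_coordinates a phi.
Proof.
move=> [j0 aj0]; pose v : 'cV[K]_n.+1 := \col_j a j.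
have v1 : \rank v = 1%N.
  apply/eqP; rewrite eqn_leq rank_leq_col lt0n mxrank_eq0.
  by apply: contraNneq aj0 => /colP/(_ j0); rewrite !mxE => ->.
pose M := col_ebase v; have Munit : M \in unitmx := col_ebase_unit v.
pose R := row_ebase v; have Runit : R \in unitmx := row_ebase_unit v.
have R0 : R 0 0 != 0 by move: Runit; rewrite unitmxE det_mx11 unitfE.
have aE j : a j = R 0 0 * M j 0.
  have := mulmx_ebase v; rewrite v1 => /colP/(_ j); rewrite -/M -/R !mxE => <-.
  rewrite big_ord1 mulrC; congr (_ * _); rewrite mxE (bigD1 ord0) //=.
  rewrite mxE eqxx mulr1 big1 ?addr0 // => i i0.
  by rewrite mxE (_ : (i == 0%N :> nat) = false) ?mulr0 //; apply: negbTE.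
pose phi j := (M j 0)%:A + \sum_s M j (lift ord0 s) *: germ_var K s.
have at0var s : germ_at0 (germ_var K s) = 0 :> K.
  by rewrite /germ_at0 /= eq_sym mnm1_eq0.
have D0var s t : germ_at0 (germ_deriv t (germ_var K s)) = (s == t)%:R :> K.
  by rewrite /germ_at0 /= /mseries_deriv mnm0E mul1r add0m eq_mnm1 eq_sym.
have at0phi j : germ_at0 (phi j) = M j 0.
  rewrite rmorphD /= germ_at0A raddf_sum big1 ?addr0 //= => s _.
  by rewrite germ_at0Z at0var mulr0.
have D0phi j t : germ_at0 (germ_deriv t (phi j)) = M j (lift ord0 t).
  rewrite raddfD /= germ_derivA add0r !raddf_sum (bigD1 t) //= big1 ?addr0 => [|s st].
    by rewrite linearZ /= germ_at0Z D0var eqxx mulr1.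
  by rewrite linearZ /= germ_at0Z D0var (negbTE st) mulr0.
exists phi; split.
  by exists (R 0 0)^-1; rewrite ?invr_eq0 // => j; rewrite at0phi aE mulKf.
suff -> : row_mx (\col_j germ_at0 (phi j))
    (\matrix_(j, i) germ_at0 (germ_deriv i (phi j))) = M by [].
apply/matrixP => i j; rewrite mxE; case: splitP => s js; rewrite !mxE.
  by rewrite at0phi; congr (M i _); apply: val_inj; rewrite /= js ord1.
by rewrite D0phi; congr (M i _); apply: val_inj; rewrite /= js.
Qed.

End LocalCoordinates.

(** * The Hessian algebras *)

Lemma det_homog (R : comNzRingType) N k e (M : 'M[{mpoly R[N]}]_k) :
  (forall i j, M i j \is e.-homog) -> exists t, \det M \is t.-homog.
Proof.
move=> Me; have prod_homog (T : Type) (r : seq T) (F : T -> {mpoly R[N]}) :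
    (forall i, F i \is e.-homog) -> \prod_(i <- r) F i \is (size r * e).-homog.
  move=> Fe; elim: r => [|i r IH]; first by rewrite big_nil dhomog1.
  by rewrite big_cons mulSn; apply: dhomogM.
exists (size (index_enum 'I_k) * e)%N; apply: rpred_sum => s _.
by rewrite mulr_sign; case: ifP => _; rewrite ?rpredN; apply: prod_homog.
Qed.

Section HessianAlgebra.
Variables (n : nat) (K : numClosedFieldType) (f : {mpoly K[n.+1]}) (d : nat).
Hypothesis fd : f \is d.-homog.
Hypothesis d0 : (0 < d)%N.

Local Notation Df := (@mderiv n.+1 K).
Local Notation G k := (partials Df f `|` minors k (hess Df f)).

Lemma hess_homog_set k : homog_set (G k).
Proof.
move=> _ [[j ->]|[r [c [_ _ ->]]]]; first by exists d.-1; apply: dhomog_deriv.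
by apply: (@det_homog _ _ _ d.-2) => i j; rewrite !mxE; do 2 apply: dhomog_deriv.
Qed.

Lemma partials_singular y : (exists j, y j != 0) ->
  (forall g, partials (@mderiv n.+1 K) f g -> g.@[y] = 0) -> singular_point f y.
Proof.
move=> y0 yP; have fy j : (f^`M(j)).@[y] = 0 by apply: yP; exists j.
split=> //; have /(congr1 (meval y)) := euler_formula fd.
rewrite raddf_sum big1 /= => [|j _]; last by rewrite mevalM fy mulr0.
by rewrite mevalZ => /esym/eqP; rewrite mulf_eq0 pnatr_eq0 eqn0Ngt d0 => /eqP.
Qed.

Variables (p : nat) (a : 'I_p -> 'I_n.+1 -> K).
Hypothesis fa : singular_locus_is f a.

(** Any local equation can be put in the form [u * f(psi)] with [psi] lifting
    to the affine hyperplane [l = 1], where the local quotient of the affine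
    algebra is computed. *)
Theorem hess_algebra_dim_chi k : exists chi : 'I_p -> nat,
  (forall i, chi_is f k (a i) (chi i)) /\
  exists m0, forall m, (m0 <= m)%N -> hess_algebra_dim f k m (\sum_(i < p) chi i)%N.
Proof.
have [asing ainj aall] := fa.
have [l l1 la] : exists2 l : {mpoly K[n.+1]},
    l \is 1.-homog & forall i, l.@[a i] != 0.
  by apply: linear_form_avoiding => i; have [] := asing i.
pose x i j := (l.@[a i])^-1 * a i j.
have lx i : l.@[x i] = 1.
  by rewrite (meval_homog _ _ l1) expr1 mulVf.
have xinj : injective x.
  move=> i j xij; apply: ainj; exists (l.@[a i] / l.@[a j]).
    by rewrite mulf_neq0 ?invr_eq0.
  by move=> t; rewrite -mulrA -/(x j t) -xij /x mulrA mulfV // mul1r.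
have Gzeros y : (exists j, y j != 0) -> (forall g, G k g -> g.@[y] = 0) ->
    exists i c, forall j, y j = c * x i j.
  move=> y0 yG; have [|i [c c0 yc]] := aall y.
    by apply: partials_singular => // g gP; apply: yG; left.
  exists i, (c * l.@[a i]) => j.
  by rewrite yc /x -mulrA [l.@[_] * _]mulrA mulfV // mul1r.
have Ghom := @hess_homog_set k.
set B := ideal_gen (G k `|` [set l - 1]).
have Balg : coords_algebraic B := affine_algebraic Ghom l1 lx Gzeros.
have /choice[chi chiP] i := local_quot_dim Ghom l1 lx Gzeros i.
exists chi; split; last exact: (hilbert_function_local Ghom l1 lx xinj Gzeros).
move=> i; split.
  have [phi aphi] : exists phi, local_coordinates (a i) phi.
    by apply: local_coordinates_exist; have [] := asing i.
  exists (1 * mpoly_germ phi f), phi, 1; split=> //.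
  by rewrite rmorph1 oner_eq0.
move=> _ [phi [u [aphi u0 ->]]]; have [[c c0 phia] _] := aphi.
pose lphi := mpoly_germ phi l.
have lphi0 : germ_at0 lphi = c * l.@[a i].
  by rewrite mpoly_germ_at0 (meval_eq l phia) (meval_homog _ _ l1) expr1.
have [w lw] : exists w, lphi * w = 1 by apply: germ_inverse; rewrite lphi0 mulf_neq0.
have w0E : c * l.@[a i] * germ_at0 w = 1 by rewrite -lphi0 -rmorphM lw rmorph1.
have w0 : germ_at0 w != 0.
  by apply: contra_eq_neq w0E => ->; rewrite mulr0 eq_sym oner_eq0.
pose psi j := w * phi j.
have [_ psi_unit] := local_coordinates_scale w0 aphi.
have psil : mpoly_germ psi l = 1.
  by rewrite (mpoly_germ_homog _ _ l1) expr1 mulrC.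
have psix : (fun j => germ_at0 (psi j)) = x i.
  apply: funext => j; rewrite rmorphM /= phia /x mulrA; congr (_ * _).
  by apply: (mulIf (la i)); rewrite mulVf // -w0E -[LHS]mulrA [LHS]mulrC.
have phif : u * mpoly_germ phi f = (u * lphi ^+ d) * mpoly_germ psi f.
  rewrite (mpoly_germ_homog _ _ fd) mulrA -[u * _ * _]mulrA -exprMn lw.
  by rewrite expr1n mulr1.
rewrite /local_hess_algebra_dim phif local_hess_ideal_unit; last first.
  by rewrite rmorphM rmorphXn /= lphi0 mulf_neq0 ?expf_neq0 ?mulf_neq0.
rewrite -(hess_ideal_local psi_unit fd d0).
apply: (local_quot_dim_germ psi_unit l1 psil Balg).
by rewrite psix; apply: chiP.
Qed.

End HessianAlgebra.
Theorem theorem1p1 (R : realType) (n d p : nat) (f : {mpoly R[i][n.+1]})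
    (a : 'I_p -> 'I_n.+1 -> R[i]) :
  (0 < d)%N -> f != 0 -> f \is d.-homog ->
  reduced_hypersurface f ->
  singular_locus_is f a ->
  forall k : nat, (1 <= k <= n.+1)%N ->
  exists chi : 'I_p -> nat,
    (forall i, chi_is f k (a i) (chi i)) /\
    exists m0 : nat, forall m : nat, (m0 <= m)%N ->
      hess_algebra_dim f k m (\sum_(i < p) chi i)%N.
Proof. by move=> d0 _ fd _ fa k _; apply: hess_algebra_dim_chi fd d0 _ _ fa k. Qed.
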